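(* Let $\mathcal C\subseteq P^{\circ\bullet}$ be a globally colorized category of partitions, let $k:=k(\mathcal C)$, and let $n\in\mathbb N$. Let $H\subseteq O_n^+$ be the quantum group (of size $n$) corresponding to the non-colored category $\langle\mathcal C,\sqcap_{\circ\circ}\rangle$. Then the quantum group (of size $n$) corresponding to $\mathcal C$ is $H\mathbin{\tilde\times}\hat{\mathbb Z}_k\subseteq U_n^+$, where in the case $k=0$ the quantum group $\hat{\mathbb Z}_k$ is replaced by $\hat{\mathbb Z}$. Conversely, any quantum group of the form $H\mathbin{\tilde\times}\hat{\mathbb Z}_k$, where $H$ is an orthogonal easy quantum group and $k\in\mathbb N_0$ (with $\hat{\mathbb Z}$ in place of $\hat{\mathbb Z}_k$ for $k=0$), is a unitary easy quantum group corresponding to a globally colorized category.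
   Context: **Partitions.** $P^{\circ\bullet}(k)$ is the set of two-colored partitions of $k$ points: set partitions of $\{1,\dots,k\}$ into blocks together with a color, white $\circ$ or black $\bullet$, for each point ($k\in\mathbb N_0=\{0,1,2,\dots\}$); $P^{\circ\bullet}=\bigcup_kP^{\circ\bullet}(k)$. Category operations: tensor product $p\otimes q$ (concatenation side by side); contraction $\Pi_ip$ for $p$ of length $k$, allowed when points $i$ and $i+1$ (cyclically; point $k+1$ is point 1) have different colors: merge the blocks of these two points and delete both points; reflection $\tilde p$ (reverse the order of points and invert all colors); rotation $Rp$ (move the last point to the front, keeping its block and color). $\sqcap_{ab}$ denotes two points in one block with colors $a,b$. A category of partitions is a subset of $P^{\circ\bullet}$ closed under the category operations and containing $\sqcap_{\circ\bullet},\sqcap_{\bullet\circ}$; $\langle\cdots\rangle$ is the smallest category containing the given elements. A category is non-colored if it contains $\sqcap_{\circ\circ}$ and globally colorized if it contains $\sqcap_{\circ\circ}\otimes\sqcap_{\bullet\bullet}$. $c(p)$ is the number of white points minus the number of black points of $p$; $k(\mathcal C)$ is the minimum of all $c(p)>0$ with $p\in\mathcal C$ if such $p$ exists, and $0$ otherwise. **Compact matrix quantum groups.** A compact matrix quantum group is a pair $G=(A,u)$, where $A=:C(G)$ is a C*-algebra, $u=(u_{ij})\in M_n(A)$ (the fundamental representation), the $u_{ij}$ generate $A$, $u$ and $u^t=(u_{ji})$ are invertible, and $u_{ij}\mapsto\sum_ku_{ik}\otimes u_{kj}$ defines a $*$-homomorphism $\Delta:A\to A\otimes_{\min}A$. $H\subseteq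 G$ means that the fundamental representations have the same size and there is a $*$-homomorphism $C(G)\to C(H)$ with $u^G_{ij}\mapsto u^H_{ij}$. Two compact matrix quantum groups are identical (equal) if their fundamental representations have the same size and there is a $*$-isomorphism of the C*-algebras mapping $u_{ij}\mapsto v_{ij}$. $U_n^+$: $C(U_n^+)$ is the universal C*-algebra generated by $u_{ij}$ such that $u$ and $u^t$ are unitary. $O_n^+$: $C(O_n^+)$ is the universal C*-algebra generated by $u_{ij}$ with $u_{ij}=u_{ij}^*$ and $uu^t=u^tu=1$. A quantum group is unitary, resp. orthogonal, if it is a quantum subgroup of $U_n^+$, resp. $O_n^+$. **Easy quantum groups.** For $p\in P^{\circ\bullet}(k)$ with color pattern $(s_1,\dots,s_k)$ and $\alpha\in\{1,\dots,n\}^k$, let $\delta_p(\alpha)=1$ if $\alpha$ is constant on the blocks of $p$ and $0$ otherwise. The relation $R_p(u)$ is: for all $\beta\in\{1,\dots,n\}^k$, $\delta_p(\beta)=\sum_{\gamma_1,\dots,\gamma_k=1}^n\delta_p(\gamma)u^{s_1}_{\beta_1\gamma_1}\cdots u^{s_k}_{\beta_k\gamma_k}$, where $u^\circ_{ij}=u_{ij}$, $u^\bullet_{ij}=u_{ij}^*$. The (easy) quantum group of size $n$ corresponding to a category $\mathcal C$ is $(A,u)$ with $A$ the universal C*-algebra generated by $u_{ij}$, $1\le i,j\le n$, subject to $u,u^t$ unitary and $R_p(u)$ for all $p\in\mathcal C$. An orthogonal easy quantum group is one corresponding to a non-colored category (equivalently, an easy quantum group that is a quantum subgroup of $O_n^+$).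 **Tensor complexification.** $\hat{\mathbb Z}_k=(C^*(\mathbb Z_k),(z))$ and $\hat{\mathbb Z}=(C^*(\mathbb Z),(z))$, where $C^*(\mathbb Z_k)$ is the universal C*-algebra generated by $z$ with $zz^*=z^*z=1$, $z^k=1$, and $C^*(\mathbb Z)$ the one with $zz^*=z^*z=1$ only. For $G=(C(G),u)$, $H=(C(H),v)$, the glued tensor product is $G\mathbin{\tilde\times}H=(A,u\otimes v)$, where $A\subseteq C(G)\otimes_{\max}C(H)$ is the C*-subalgebra generated by the products $u_{ij}v_{kl}$ (identified with $u_{ij}\otimes v_{kl}$). In particular $G\mathbin{\tilde\times}\hat{\mathbb Z}_k$ has fundamental representation $(u_{ij}z)$. *)

(* Defs.v *)
From HB Require Import structures.
From mathcomp Require Import all_boot all_order all_algebra.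
From mathcomp Require Import complex mxtens.
From mathcomp Require Import all_classical all_reals all_analysis.

Set Implicit Arguments.
Unset Strict Implicit.
Unset Printing Implicit Defensive.

Import Order.TTheory GRing.Theory Num.Theory.
Import numFieldNormedType.Exports.

Local Open Scope classical_set_scope.
Local Open Scope ring_scope.

(** * Two-colored partitions *)

(* The points 1, ..., k are the ordinals 0, ..., k-1. *)
Notation white := true (only parsing).
Notation black := false (only parsing).

Record cpart (k : nat) := CPart {
  blocks : {set {set 'I_k}};
  blocksP : finset.partition blocks [set: 'I_k]%SET;
  color : {ffun 'I_k -> bool} }.

Definition cpartition := {k : nat & cpart k}.
Definition pack k (p : cpart k) : cpartition := Tagged cpart p.

(* The block containing x. *)
Definition block k (p : cpart k) (x : 'I_k) : {set 'I_k} := finset.pblock (blocks p) x.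

(* The partition whose blocks are the nonempty fibres of f. *)
Definition fibre_part k (T : eqType) (f : 'I_k -> T) (c : 'I_k -> bool) :
  cpart k := CPart (preim_partitionP f [set: 'I_k]%SET) (finfun c).

Definition sqcap (a b : bool) : cpart 2 :=
  fibre_part (fun=> tt) (fun x => if x == ord0 then a else b).

Definition ptens k l (p : cpart k) (q : cpart l) : cpart (k + l) :=
  fibre_part
    (fun x : 'I_(k + l) => match fintype.split x with
              | inl a => inl (block p a)
              | inr b => inr (block q b)
              end : ({set 'I_k} + {set 'I_l})%type)
    (fun x : 'I_(k + l) => match fintype.split x with
              | inl a => color p a
              | inr b => color q b
              end).

Definition preflect k (p : cpart k) : cpart k :=
  fibre_part (fun x => block p (rev_ord x)) (fun x => ~~ color p (rev_ord x)).

(* Point x of the rotated partition is the point x - 1 (mod k) of p. *)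
Definition protate k (p : cpart k) : cpart k :=
  fibre_part (fun x => block p (ord_pred x)) (fun x => color p (ord_pred x)).

(* The increasing enumeration of the points other than i and its cyclic
   successor [ordS i]; for the last point i, the successor is the first one. *)
Definition skip2 k (i : 'I_k.+2) (x : 'I_k) : 'I_k.+2 :=
  inord (if i == ord_max then x.+1 else if (x < i)%N then x : nat else x.+2).

Definition pcontract k (i : 'I_k.+2) (p : cpart k.+2) : cpart k :=
  fibre_part
    (fun x => if block p (skip2 i x) == block p (ordS i) then block p i
              else block p (skip2 i x))
    (fun x => color p (skip2 i x)).

Record is_category (C : set cpartition) : Prop := IsCategory {
  cat_wb : C (pack (sqcap white black));
  cat_bw : C (pack (sqcap black white));
  cat_tens : forall k l (p : cpart k) (q : cpart l),
    C (pack p) -> C (pack q) -> C (pack (ptens p q));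
  cat_contract : forall k (i : 'I_k.+2) (p : cpart k.+2),
    color p i != color p (ordS i) -> C (pack p) -> C (pack (pcontract i p));
  cat_reflect : forall k (p : cpart k), C (pack p) -> C (pack (preflect p));
  cat_rotate : forall k (p : cpart k), C (pack p) -> C (pack (protate p)) }.

Definition generated_category (S : set cpartition) : set cpartition :=
  smallest is_category S.

Definition non_colored (C : set cpartition) : Prop :=
  C (pack (sqcap white white)).

Definition globally_colorized (C : set cpartition) : Prop :=
  C (pack (ptens (sqcap white white) (sqcap black black))).

Definition color_sum k (p : cpart k) : int :=
  \sum_(x < k) (if color p x == white then 1 else -1).

Definition has_color_sum (C : set cpartition) (m : nat) : bool :=
  (0 < m)%N && `[< exists k (p : cpart k), C (pack p) /\ color_sum p = m%:Z >].

Definition kcat (C : set cpartition) : nat :=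
  match pselect (exists m, has_color_sum C m) with
  | left ex_m => ex_minn ex_m
  | right _ => 0%N
  end.

(** * C*-algebras *)

(* Unital, nonzero C*-algebras: complex Banach spaces with a product and an
   involution. The norm takes its (real) values in R[i]. The product is a raw
   field here because the hierarchy has no join of normed modules and rings
   other than the ordered ones; the algebra structure is an instance below. *)
HB.mixin Record isCStar (R : realType) A of CompleteNormedModule R[i] A := {
  cone : A;
  cmul : A -> A -> A;
  star : A -> A;
  cmulA : associative cmul;
  cmul1x : left_id cone cmul;
  cmulx1 : right_id cone cmul;
  cmulDl : left_distributive cmul +%R;
  cmulDr : right_distributive cmul +%R;
  cone_neq0 : cone != 0;
  cmulZl : forall (a : R[i]) (x y : A), a *: cmul x y = cmul (a *: x) y;
  cmulZr : forall (a : R[i]) (x y : A), a *: cmul x y = cmul x (a *: y);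
  starK : involutive star;
  starD : {morph star : x y / x + y};
  starZ : forall (a : R[i]) (x : A), star (a *: x) = a^* *: star x;
  star_cmul : forall x y : A, star (cmul x y) = cmul (star y) (star x);
  norm_cmul : forall x y : A, `|cmul x y| <= `|x| * `|y|;
  norm_star : forall x : A, `|cmul (star x) x| = `|x| ^+ 2 }.

#[short(type="cstarType")]
HB.structure Definition CStar (R : realType) :=
  {A of isCStar R A & CompleteNormedModule R[i] A}.

#[non_forgetful_inheritance]
HB.instance Definition _ (R : realType) (A : cstarType R) :=
  GRing.Zmodule_isNzRing.Build (CStar.sort A)
    cmulA cmul1x cmulx1 cmulDl cmulDr cone_neq0.
#[non_forgetful_inheritance]
HB.instance Definition _ (R : realType) (A : cstarType R) :=
  GRing.Lmodule_isLalgebra.Build R[i] (CStar.sort A) cmulZl.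
#[non_forgetful_inheritance]
HB.instance Definition _ (R : realType) (A : cstarType R) :=
  GRing.Lalgebra_isAlgebra.Build R[i] (CStar.sort A) cmulZr.

Lemma starM (R : realType) (A : cstarType R) (x y : A) :
  star (x * y) = star y * star x.
Proof. exact: star_cmul. Qed.

Lemma normM_le (R : realType) (A : cstarType R) (x y : A) :
  `|x * y| <= `|x| * `|y|.
Proof. exact: norm_cmul. Qed.

Lemma norm_starM (R : realType) (A : cstarType R) (x : A) :
  `|star x * x| = `|x| ^+ 2.
Proof. exact: norm_star. Qed.

Record starHom (R : realType) (A B : cstarType R) := StarHom {
  starHom_fun :> {lrmorphism A -> B};
  starHomP : {morph starHom_fun : x / star x} }.

Record cstar_subalg (R : realType) (A : cstarType R) (S : set A) : Prop :=
  CStarSubalg {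
    subalg_closed : closed S;
    subalg1 : S 1;
    subalgD : forall x y, S x -> S y -> S (x + y);
    subalgZ : forall (a : R[i]) x, S x -> S (a *: x);
    subalgM : forall x y, S x -> S y -> S (x * y);
    subalg_star : forall x, S x -> S (star x) }.

Definition cstar_gen (R : realType) (A : cstarType R) (X : set A) : set A :=
  smallest (@cstar_subalg R A) X.

(** * Tensor products of C*-algebras *)

Definition commuting (R : realType) (A B T : cstarType R)
    (i : starHom A T) (j : starHom B T) : Prop :=
  forall a b, i a * j b = j b * i a.

(* T is the completion of the algebraic tensor product of A and B for some
   C*-norm, a \otimes b being i a * j b. The third clause says that the map
   from the algebraic tensor product to T is injective. *)
Record cstar_tensor (R : realType) (A B T : cstarType R)
    (i : starHom A T) (j : starHom B T) : Prop := CStarTensor {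
  tensor_comm : commuting i j;
  tensor_gen : cstar_gen (range i `|` range j) = setT;
  tensor_inj : forall m (a : 'I_m -> A) (b : 'I_m -> B),
    (forall c : 'I_m -> R[i], \sum_k c k *: a k = 0 -> forall k, c k = 0) ->
    \sum_k i (a k) * j (b k) = 0 -> forall k, b k = 0 }.

Definition max_tensor (R : realType) (A B T : cstarType R)
    (i : starHom A T) (j : starHom B T) : Prop :=
  cstar_tensor i j /\
  forall (D : cstarType R) (f : starHom A D) (g : starHom B D),
    commuting f g ->
    exists h : starHom T D,
      (forall a, h (i a) = f a) /\ (forall b, h (j b) = g b).

(* The spatial norm is the least C*-norm on the algebraic tensor product. *)
Definition min_tensor (R : realType) (A B T : cstarType R)
    (i : starHom A T) (j : starHom B T) : Prop :=
  cstar_tensor i j /\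
  forall (T' : cstarType R) (i' : starHom A T') (j' : starHom B T'),
    cstar_tensor i' j' ->
    forall m (a : 'I_m -> A) (b : 'I_m -> B),
      `|\sum_k i (a k) * j (b k)| <= `|\sum_k i' (a k) * j' (b k)|.

(** * Compact matrix quantum groups *)

(* A pair (C(G), u) of size n; [cmqg] are the axioms. *)
Record qgroup (R : realType) (n : nat) := QGroup {
  qalg : cstarType R;
  qfund : 'M[qalg]_n }.

Definition entries (T : Type) (n : nat) (u : 'M[T]_n) : set T :=
  [set x | exists i j, x = u i j].

Definition invertible_mx (A : nzRingType) n (u : 'M[A]_n) : Prop :=
  exists v : 'M[A]_n, u *m v = 1%:M /\ v *m u = 1%:M.

(* The comultiplication takes values in any model (T, i, j) of the minimal
   tensor product of C(G) with itself; all models are isomorphic. *)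
Record cmqg (R : realType) n (G : qgroup R n) : Prop := CMQG {
  cmqg_gen : cstar_gen (entries (qfund G)) = setT;
  cmqg_inv : invertible_mx (qfund G);
  cmqg_trinv : invertible_mx (qfund G)^T;
  cmqg_comul : forall (T : cstarType R) (i j : starHom (qalg G) T),
    min_tensor i j ->
    exists Delta : starHom (qalg G) T, forall a b,
      Delta (qfund G a b) = \sum_k i (qfund G a k) * j (qfund G k b) }.

Definition qg_sub (R : realType) m n (H : qgroup R m) (G : qgroup R n) : Prop :=
  exists (e : n = m) (f : starHom (qalg G) (qalg H)), forall a b,
    f (qfund G a b) = qfund H (cast_ord e a) (cast_ord e b).

Definition qg_eq (R : realType) m n (G : qgroup R m) (H : qgroup R n) : Prop :=
  exists (e : m = n) (f : starHom (qalg G) (qalg H)), bijective f /\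
    forall a b, f (qfund G a b) = qfund H (cast_ord e a) (cast_ord e b).

(* C(G) is the universal C*-algebra generated by the entries of the
   fundamental representation subject to the relations rel. *)
Definition universal (R : realType) n
    (rel : forall A : cstarType R, 'M[A]_n -> Prop) (G : qgroup R n) : Prop :=
  [/\ rel (qalg G) (qfund G),
      cstar_gen (entries (qfund G)) = setT
    & forall (B : cstarType R) (w : 'M[B]_n), rel B w ->
        exists f : starHom (qalg G) B, forall a b, f (qfund G a b) = w a b].

Definition adjoint_mx (R : realType) (A : cstarType R) n (u : 'M[A]_n) :
  'M[A]_n := \matrix_(a, b) star (u b a).

Definition unitary_mx (R : realType) (A : cstarType R) n (u : 'M[A]_n) : Prop :=
  u *m adjoint_mx u = 1%:M /\ adjoint_mx u *m u = 1%:M.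

Definition Uplus_rel (R : realType) n (A : cstarType R) (u : 'M[A]_n) : Prop :=
  unitary_mx u /\ unitary_mx u^T.

Definition Oplus_rel (R : realType) n (A : cstarType R) (u : 'M[A]_n) : Prop :=
  [/\ forall a b, star (u a b) = u a b, u *m u^T = 1%:M & u^T *m u = 1%:M].

Definition is_Uplus (R : realType) n (U : qgroup R n) : Prop :=
  universal (@Uplus_rel R n) U.

Definition is_Oplus (R : realType) n (O : qgroup R n) : Prop :=
  universal (@Oplus_rel R n) O.

Definition unitary_qg (R : realType) m (G : qgroup R m) : Prop :=
  forall U : qgroup R m, is_Uplus U -> qg_sub G U.

Definition orthogonal_qg (R : realType) m (G : qgroup R m) : Prop :=
  forall O : qgroup R m, is_Oplus O -> qg_sub G O.

(** * Easy quantum groups *)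

Definition delta k n (p : cpart k) (f : {ffun 'I_k -> 'I_n}) : bool :=
  [forall B in blocks p, forall x in B, forall y in B, f x == f y].

Definition colored (R : realType) (A : cstarType R) n (u : 'M[A]_n)
    (s : bool) (a b : 'I_n) : A :=
  if s == white then u a b else star (u a b).

Definition part_rel (R : realType) (A : cstarType R) n (u : 'M[A]_n)
    k (p : cpart k) : Prop :=
  forall be : {ffun 'I_k -> 'I_n},
    (delta p be)%:R =
    \sum_(ga : {ffun 'I_k -> 'I_n})
      (delta p ga)%:R * \prod_(x < k) colored u (color p x) (be x) (ga x) :> A.

Definition easy_rel (R : realType) (C : set cpartition) n (A : cstarType R)
    (u : 'M[A]_n) : Prop :=
  Uplus_rel u /\ forall k (p : cpart k), C (pack p) -> part_rel u p.

(* G is the quantum group of size n corresponding to C. *)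
Definition easy_qg (R : realType) (C : set cpartition) n (G : qgroup R n) :
  Prop := universal (@easy_rel R C n) G.

Definition orthogonal_easy (R : realType) n (G : qgroup R n) : Prop :=
  exists C : set cpartition, [/\ is_category C, non_colored C & easy_qg C G].

(** * Tensor complexification *)

(* For k = 0 the last relation is void, so this is the dual of Z. *)
Definition dual_cyclic_rel (R : realType) (k : nat) (A : cstarType R)
    (z : 'M[A]_1) : Prop :=
  [/\ z 0 0 * star (z 0 0) = 1, star (z 0 0) * z 0 0 = 1 & z 0 0 ^+ k = 1].

Definition is_dual_cyclic (R : realType) (k : nat) (Z : qgroup R 1) : Prop :=
  universal (@dual_cyclic_rel R k) Z.

(* K is the glued tensor product of G and H: iota identifies C(K) with the
   C*-subalgebra of the maximal tensor product generated by the products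
   u_ab v_cd, and the fundamental representation of K with u \otimes v, the
   double index (a, c) being encoded as in [tensmx]. *)
Definition is_glued (R : realType) m n (G : qgroup R m) (H : qgroup R n)
    (K : qgroup R (m * n)) : Prop :=
  exists (T : cstarType R) (i : starHom (qalg G) T) (j : starHom (qalg H) T)
         (iota : starHom (qalg K) T),
    [/\ max_tensor i j,
        injective iota,
        range iota = cstar_gen
          [set x | exists a b c d, x = i (qfund G a b) * j (qfund H c d)]
      & forall a b c d,
          iota (qfund K (mxtens_index (a, c)) (mxtens_index (b, d))) =
          i (qfund G a b) * j (qfund H c d)].

(* Main.v *)
From HB Require Import structures.
Require Import Defs.
From mathcomp Require Import all_boot all_order all_algebra.
From mathcomp Require Import complex mxtens.
From mathcomp Require Import all_classical all_reals all_analysis.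
From mathcomp Require Import lra zify.

Set Implicit Arguments.
Unset Strict Implicit.
Unset Printing Implicit Defensive.

Import Order.TTheory GRing.Theory Num.Theory.
Import numFieldNormedType.Exports.

Local Open Scope classical_set_scope.
Local Open Scope complex_scope.
Local Open Scope ring_scope.

(** Why the theorem holds.  Let w be a matrix over a C*-algebra B that satisfies
    the relations of a globally colorized category.  For X = w w^T the relation
    of the two pairs (white white) and (black black) side by side reads
    X_ab star(X_dc) = delta_ab delta_cd; as X is unitary, it must be t 1 for a
    unitary t, which means w_ab = t star(w_ab), and t commutes with all w_ab
    ([colorized_unitary]).  If t = z^2 with z unitary and commuting with w,
    then u = z^-1 w has self-adjoint entries, is orthogonal, commutes with z,
    and w = z u: this is exactly how the fundamental representation of the
    glued product of H and the dual of Z_k arises ([splits]).  Since z is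
    central, the relation of a partition p for w and the one for u differ by
    the factor z^c(p) only ([rho_scaled]).  If z^k = 1 and k divides c(p), the
    two are equivalent.  So C(K) satisfies the relations of the category; and
    as soon as every w as above can be split with z^k = 1 and with u satisfying
    the relations of H, the universal properties of C(H), of C*(Z_k) and of the
    maximal tensor product yield a homomorphism defined on C(K) that maps u z
    to w ([glued_univ]), which is the universal property of the easy quantum
    group.

    The square root z need not exist in B.  It always exists in the 2 x 2
    matrices over B, as the matrix with rows (0 t) and (1 0)
    ([sqrt_extension]); a homomorphism into these matrices that maps generators
    to scalar matrices over B takes its values in them.  For this the matrices
    over a C*-algebra are made a C*-algebra, with the operator norm on the
    Hilbert module B^n; Cauchy-Schwarz rests on the positivity of star(x) x.
    Positivity is derived from a square root obtained by an iteration.  It also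
    shows that homomorphisms are contractive, and isometric when injective, so
    that the entries of K generate C(K).

    The condition z^k = 1.  If w satisfies the relation of a partition p with an
    even number of points, compare the invariant vectors of p and of the
    partition into consecutive pairs: their inner product is a positive
    integer, and it equals z^c(p) times itself, so z^c(p) = 1 ([zpow_even]).
    A partition with c(p) = k gives z^k = 1 when k is even; when k is odd, two
    copies of it give z^2k = 1, and z is replaced by z^(k+1), another square
    root of t ([choose_root]).

    The relations of H.  The partitions whose relation holds for a fixed u form
    a category ([part_rel_category]).  For the first statement this category
    contains C and the white pair, hence the category generated by them.  For
    the converse, the category attached to K is the one of all partitions whose
    relation holds for the fundamental representation of K; any partition of H
    belongs to it after recoloring (and, for odd k, adding pairs) provided its
    color sum can be made divisible by k.  This fails only for partitions with
    an odd number of points when k is even: there u satisfies the relations up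
    to a central self-adjoint unitary r, common to all of them, and z r, r u is
    the splitting wanted ([split_choose_sign]). *)

(** * Positivity in C*-algebras *)

Section Star.
Variables (R : realType) (A : cstarType R).
Implicit Types x y : A.

Lemma star0 : star 0 = 0 :> A.
Proof. by have := starZ 0 (0 : A); rewrite conjC0 !scale0r. Qed.
Lemma starN x : star (- x) = - star x.
Proof. by rewrite -scaleN1r starZ rmorphN rmorph1 scaleN1r. Qed.
Lemma starB x y : star (x - y) = star x - star y.
Proof. by rewrite starD starN. Qed.
Lemma star1 : star 1 = 1 :> A.
Proof. by have := starM (star (1 : A)) 1; rewrite !mulr1 !starK mulr1. Qed.
Lemma star_sum I (r : seq I) (P : pred I) (F : I -> A) :
  star (\sum_(i <- r | P i) F i) = \sum_(i <- r | P i) star (F i).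
Proof. exact: (big_morph _ (@starD R A) star0). Qed.
Lemma star_nat n : star (n%:R : A) = n%:R.
Proof.
elim: n => [|n IHn]; first exact: star0.
by rewrite -addn1 natrD starD IHn star1.
Qed.

Lemma starZr (c : R) x : star (c%:C *: x) = c%:C *: star x.
Proof.
rewrite starZ; congr (_ *: _).
by apply/eqP; rewrite eq_complex/= oppr0 !eqxx.
Qed.
Lemma halfK x : (2^-1 : R)%:C *: x + (2^-1 : R)%:C *: x = x.
Proof.
rewrite -scalerDl -rmorphD/= (_ : 2^-1 + 2^-1 = 1 :> R) ?scale1r//; lra.
Qed.
Lemma adjoint_mulmx n (u v : 'M[A]_n) :
  adjoint_mx (u *m v) = adjoint_mx v *m adjoint_mx u.
Proof.
apply/matrixP => i j; rewrite !mxE star_sum; apply: eq_bigr => k _.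
by rewrite !mxE starM.
Qed.

(** The norm takes its values in the partially ordered field R[i]; this is the
    same number in the totally ordered field R. *)
Definition rnorm x : R := complex.Re `|x|.

Lemma normE x : `|x| = (rnorm x)%:C.
Proof. by rewrite RRe_real// normr_real. Qed.
Lemma rnorm_ge0 x : 0 <= rnorm x.
Proof. by rewrite -lecR -normE normr_ge0. Qed.
Lemma rnorm0 : rnorm 0 = 0.
Proof. by rewrite /rnorm normr0. Qed.
Lemma rnorm0_eq0 x : rnorm x = 0 -> x = 0.
Proof. by move=> h; apply/eqP; rewrite -normr_eq0 normE h. Qed.
Lemma rnormN x : rnorm (- x) = rnorm x.
Proof. by rewrite /rnorm normrN. Qed.
Lemma rnormBC x y : rnorm (x - y) = rnorm (y - x).
Proof. by rewrite -rnormN opprB. Qed.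
Lemma rnormD x y : rnorm (x + y) <= rnorm x + rnorm y.
Proof. by rewrite -lecR rmorphD/= -!normE ler_normD. Qed.
Lemma rnormB x y : rnorm (x - y) <= rnorm x + rnorm y.
Proof. by rewrite -(rnormN y) rnormD. Qed.
Lemma rnormM x y : rnorm (x * y) <= rnorm x * rnorm y.
Proof. by rewrite -lecR rmorphM/= -!normE normM_le. Qed.
Lemma rnorm_starM x : rnorm (star x * x) = rnorm x ^+ 2.
Proof. by apply: complexI; rewrite rmorphXn/= -!normE norm_starM. Qed.
Lemma rnorm_sqr x : star x = x -> rnorm (x * x) = rnorm x ^+ 2.
Proof. by move=> {1}<-; rewrite rnorm_starM. Qed.
Lemma rnorm_star x : rnorm (star x) = rnorm x.
Proof.
have le y : rnorm y <= rnorm (star y).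
  have [/eqP->|y0] := boolP (y == 0); first by rewrite star0.
  have p : 0 < rnorm y.
    rewrite lt_def rnorm_ge0 andbT; apply: contra_neq y0; exact: rnorm0_eq0.
  by rewrite -(ler_pM2r p) -expr2 -rnorm_starM rnormM.
by apply/eqP; rewrite eq_le le -{2}(starK x) le.
Qed.
Lemma rnormZ (c : R) x : rnorm (c%:C *: x) = `|c| * rnorm x.
Proof.
apply: complexI.
by rewrite rmorphM/= -!normE normrZ normc_def/= expr0n addr0 sqrtr_sqr.
Qed.
Lemma rnorm1 : rnorm 1 = 1.
Proof.
have := rnorm_starM 1; rewrite star1 mulr1 expr2 => /esym h.
have : rnorm 1 != 0.
  by apply/eqP => /rnorm0_eq0 /eqP; rewrite oner_eq0.
by move=> n0; apply: (mulfI n0); rewrite h mulr1.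
Qed.
Lemma rnorm_half x : rnorm ((2^-1 : R)%:C *: x) = rnorm x / 2.
Proof. by rewrite rnormZ ger0_norm ?invr_ge0// mulrC. Qed.
(** The form in which identities between limits are proved below: the constant c
    absorbs the norms of the factors. *)
Lemma rnorm_small_eq0 x (c : R) : (forall e, 0 < e -> rnorm x <= c * e) -> x = 0.
Proof.
move=> h; apply: rnorm0_eq0; apply/eqP; rewrite eq_le rnorm_ge0 andbT.
apply/ler_addgt0Pr => e e0; rewrite add0r.
have [c0|c0] := leP c 0.
  apply: le_trans (h _ e0) _; apply: (@le_trans _ _ 0); last exact: ltW.
  by rewrite mulr_le0_ge0// ltW.
have := h (e / c) (divr_gt0 e0 c0); rewrite mulrC divfK//; exact: lt0r_neq0.
Qed.

Lemma closed_rnormP (S : set A) : closed S <->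
  forall x, (forall e : R, 0 < e -> exists2 y, S y & rnorm (x - y) <= e) -> S x.
Proof.
split=> [clS x h|h x clx].
  apply: clS => U /nbhs_ballP[e /= e0 sU].
  have er : e = (complex.Re e)%:C by rewrite RRe_real// gtr0_real.
  have e1 : 0 < complex.Re e by rewrite -ltcR -er.
  have [|y Sy hy] := h (complex.Re e / 2); first by rewrite divr_gt0.
  exists y; split => //; apply: sU.
  rewrite -ball_normE/= /ball_ normE er ltcR; apply: le_lt_trans hy _; lra.
apply: h => e e0.
have [|y [Sy]] := clx (ball x e%:C).
  by apply: nbhsx_ballx; rewrite ltcR.
rewrite -ball_normE/= normE ltcR => hy; exists y => //; exact: ltW.
Qed.

(** Convergence by a scalar majorant: the steps are dominated by those of a
    bounded real sequence, which is nondecreasing and hence converges. *)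
Lemma rnorm_complete (y : nat -> A) (s : nat -> R) (M : R) :
  (forall n, rnorm (y n.+1 - y n) <= s n.+1 - s n) -> (forall n, s n <= M) ->
  exists l, forall e : R, 0 < e ->
    exists N, forall n, (N <= n)%N -> rnorm (l - y n) <= e.
Proof.
move=> ys sM.
have ysD m d : rnorm (y (m + d)%N - y m) <= s (m + d)%N - s m.
  elim: d => [|d IHd]; first by rewrite addn0 !subrr rnorm0.
  rewrite addnS -(subrKA (y (m + d)%N)).
  apply: le_trans (rnormD _ _) _.
  have := ys (m + d)%N; lra.
have sN : nondecreasing_seq s.
  by apply/nondecreasing_seqP => n; rewrite -subr_ge0 (le_trans _ (ys n))// rnorm_ge0.
have cs : cvgn s.
  by apply: nondecreasing_is_cvgn => //; exists M => _ [n _ <-].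
have cauchys : forall e : R, 0 < e -> exists N, forall m d, (N <= m)%N ->
    s (m + d)%N - s m <= e.
  move=> e e0; have /cvgrPdist_le /(_ _ e0) [N _ hN] := cs.
  exists N => m d Nm; have := hN m Nm.
  have := nondecreasing_cvgn_le sN cs (m + d)%N => h1.
  rewrite ger0_norm; last by rewrite subr_ge0 nondecreasing_cvgn_le.
  by move=> h2; move: h1 h2; lra.
have cy : cauchy (y @ \oo).
  apply: cauchy_exP => e e0.
  have er : e = (complex.Re e)%:C by rewrite RRe_real// gtr0_real.
  have e1 : 0 < complex.Re e by rewrite -ltcR -er.
  have [|N hN] := cauchys (complex.Re e / 2); first by rewrite divr_gt0.
  exists (y N); exists N => // n /= Nn.
  rewrite -ball_normE/= normE er ltcR rnormBC -(subnKC Nn).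
  apply: le_lt_trans (ysD _ _) _; apply: le_lt_trans (hN _ _ (leqnn N)) _; lra.
have : cvg (y @ \oo) by exact: cauchy_cvg cy.
move=> /(cvg_ex _)[l /cvgrPdist_le hl].
exists l => e e0; have [|N _ hN] := hl e%:C; first by rewrite ltcR.
by exists N => n Nn; rewrite -lecR -normE; apply: hN.
Qed.

Lemma commute_limit (l b : A) :
  (forall e : R, 0 < e -> exists2 y, y * b = b * y & rnorm (l - y) <= e) ->
  l * b = b * l.
Proof.
move=> hl; apply/eqP; rewrite -subr_eq0; apply/eqP.
apply: (@rnorm_small_eq0 _ (2 * rnorm b)) => e e0; have [y yb hy] := hl _ e0.
have -> : l * b - b * l = (l - y) * b - b * (l - y).
  by rewrite mulrBl mulrBr yb opprB addrA subrK.
apply: le_trans (rnormB _ _) _.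
have h1 := rnormM (l - y) b; have h2 := rnormM b (l - y).
have h3 := rnorm_ge0 b; nra.
Qed.

(** With x = 1 - a the root is 1 - l for a solution l of l = (x + l^2) / 2.
    The iterates y of this equation started at 0 commute with everything that
    commutes with a, and their steps are dominated by the steps of the same
    iteration over R for x = 1, whose terms stay in [0, 1].  Thus the
    boundary case of norm exactly 1 is included. *)
Lemma sqrt_near_one (a : A) : star a = a -> rnorm (1 - a) <= 1 ->
  exists h, [/\ star h = h, h * h = a, rnorm (1 - h) <= 1
    & forall b, a * b = b * a -> h * b = b * h].
Proof.
move=> sa a1; pose x := 1 - a; pose hf : R[i] := (2^-1 : R)%:C.
pose y := fix y n := if n is m.+1 then hf *: (x + y m * y m) else 0 : A.
(* the same iteration over the reals with x = 1, which majorizes y *)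
pose s := fix s n := if n is m.+1 then (1 + s m * s m) / 2 else 0 : R.
have yS n : y n.+1 = hf *: (x + y n * y n) by [].
have sS n : s n.+1 = (1 + s n * s n) / 2 by [].
have s01 n : 0 <= s n <= 1.
  elim: n => [|n IHn]; rewrite ?sS/=; first by lra.
  by move/andP: IHn => [? ?]; apply/andP; split; nra.
have ycom b : a * b = b * a -> forall n, y n * b = b * y n.
  move=> ab; have xb : x * b = b * x by rewrite mulrBl mulrBr ab mul1r mulr1.
  elim=> [|n IHn]; first by rewrite mul0r mulr0.
  by rewrite yS -scalerAl -scalerAr mulrDl mulrDr xb -mulrA IHn mulrA IHn mulrA.
have ya n : y n * a = a * y n by apply: ycom.
have yx n : y n * x = x * y n by rewrite mulrBl mulrBr ya mul1r mulr1.
have yC m n : y m * y n = y n * y m by apply: ycom; rewrite ya.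
have ystar n : star (y n) = y n.
  elim: n => [|n IHn]; first by rewrite star0.
  by rewrite yS starZr starD starM IHn starB star1 sa.
have yn n : rnorm (y n) <= s n.
  elim: n => [|n IHn]; first by rewrite rnorm0.
  rewrite yS rnorm_half sS ler_pM2r ?invr_gt0//; apply: le_trans (rnormD _ _) _.
  apply: lerD => //; apply: le_trans (rnormM _ _) _.
  by apply: ler_pM => //; exact: rnorm_ge0.
have ys n : rnorm (y n.+1 - y n) <= s n.+1 - s n.
  elim: n => [|n IHn].
    by rewrite /= !subr0 mul0r addr0 mulr0 addr0 rnorm_half; move: a1; rewrite -/x; lra.
  have -> : y n.+2 - y n.+1 = hf *: ((y n.+1 + y n) * (y n.+1 - y n)).
    rewrite (yS n.+1) {2}(yS n) -scalerBr; congr (_ *: _).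
    rewrite opprD addrACA subrr add0r mulrDl !mulrBr (yC n (n.+1)).
    by rewrite addrA subrK.
  rewrite rnorm_half.
  have -> : s n.+2 - s n.+1 = (s n.+1 + s n) * (s n.+1 - s n) / 2.
    by have := sS n; rewrite (sS n.+1); lra.
  rewrite ler_pM2r ?invr_gt0//; apply: le_trans (rnormM _ _) _.
  apply: ler_pM => //; try exact: rnorm_ge0.
  by apply: le_trans (rnormD _ _) _; apply: lerD.
have [l hl] := rnorm_complete ys (fun n => proj2 (andP (s01 n))).
have hl1 e : 0 < e -> exists n, rnorm (l - y n) <= e.
  by move=> /hl[N hN]; exists N; apply: hN.
have lstar : star l = l.
  apply/eqP; rewrite -subr_eq0; apply/eqP; apply: (@rnorm_small_eq0 _ 2) => e e0.
  have [n hn] := hl1 _ e0.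
  have -> : star l - l = star (l - y n) - (l - y n).
    by rewrite starB ystar opprB addrA subrK.
  apply: le_trans (rnormB _ _) _; rewrite rnorm_star; lra.
have lE : l = hf *: (x + l * l).
  apply/eqP; rewrite -subr_eq0; apply/eqP.
  apply: (@rnorm_small_eq0 _ (2 + rnorm l)) => e e0.
  have [N hN] := hl _ e0.
  have h1 := hN N (leqnn N); have h2 := hN N.+1 (leqnSn N).
  have -> : l - hf *: (x + l * l) =
      (l - y N.+1) - hf *: ((l - y N) * l + y N * (l - y N)).
    have -> : (l - y N) * l + y N * (l - y N) = l * l - y N * y N.
      by rewrite mulrBl mulrBr addrA subrK.
    rewrite -[LHS](subrKA (y N.+1)); congr (_ + _).
    by rewrite -[RHS]scalerN opprB yS -scalerBr opprD addrACA subrr add0r.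
  apply: le_trans (rnormB _ _) _; rewrite rnorm_half.
  have h3 := rnormD ((l - y N) * l) (y N * (l - y N)).
  have h4 := rnormM (l - y N) l; have h5 := rnormM (y N) (l - y N).
  have h6 := yn N; have /andP[h7 h8] := s01 N.
  have h9 := rnorm_ge0 l; have h10 := rnorm_ge0 (y N).
  have h11 := rnorm_ge0 (l - y N).
  have h12 : rnorm (y N) * rnorm (l - y N) <= e by nra.
  have h13 : rnorm (l - y N) * rnorm l <= rnorm l * e by nra.
  nra.
have hfK (b : A) : hf *: b + hf *: b = b by exact: halfK.
exists (1 - l); split.
- by rewrite starB star1 lstar.
- rewrite mulrBl mul1r mulrBr mulr1.
  have : l + l = x + l * l by rewrite {1 2}lE hfK.
  move=> /eqP; rewrite -subr_eq => /eqP ll.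
  have <- : 1 - x = a by rewrite subKr.
  by rewrite -[in RHS]ll -addrA -opprD [in LHS]addrA.
- rewrite subKr; apply/ler_addgt0Pr => e /hl1[n hn].
  rewrite -(subrK (y n) l) addrC; apply: le_trans (rnormD _ _) _.
  by have := yn n; have /andP[_ ?] := s01 n; lra.
- move=> b ab; rewrite mulrBl mulrBr mul1r mulr1; congr (_ - _).
  apply: commute_limit => e /hl1[n hn]; exists (y n) => //; exact: ycom.
Qed.

Definition scal (c : R) : A := c%:C *: 1.
(** Positive elements are introduced as squares of self-adjoint elements, so that
    homomorphisms preserve them at once.  [pos_sqrt] and [pos_rnorm_sub]
    identify them with the self-adjoint elements at distance at most c from c,
    a description that is stable under sums. *)
Definition pos (a : A) := exists2 h, star h = h & a = h * h.

Lemma star_scal c : star (scal c) = scal c.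
Proof. by rewrite /scal starZr star1. Qed.
Lemma scalC c x : scal c * x = x * scal c.
Proof. by rewrite /scal -scalerAl -scalerAr mul1r mulr1. Qed.
Lemma scal0 : scal 0 = 0.
Proof. by rewrite /scal scale0r. Qed.
Lemma scalD c d : scal (c + d) = scal c + scal d.
Proof. by rewrite /scal rmorphD scalerDl. Qed.
Lemma rnorm_scal c : 0 <= c -> rnorm (scal c) = c.
Proof. by move=> c0; rewrite rnormZ rnorm1 mulr1 ger0_norm. Qed.

Lemma sqrt_near_scal (c : R) (a : A) :
  0 <= c -> star a = a -> rnorm (scal c - a) <= c ->
  exists h, [/\ star h = h, h * h = a,
    rnorm (scal (Num.sqrt c) - h) <= Num.sqrt c
    & forall b, a * b = b * a -> h * b = b * h].
Proof.
move=> c0 sa; have [<-|cN0 ac] := eqVneq 0 c.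
  rewrite scal0 sub0r rnormN => a0.
  have -> : a = 0 by apply: rnorm0_eq0; apply/eqP; rewrite eq_le a0 rnorm_ge0.
  exists 0; rewrite star0 mul0r sqrtr0 scal0 subr0 rnorm0.
  by split=> // b; rewrite mul0r mulr0.
have cp : 0 < c by rewrite lt_def eq_sym cN0.
pose a' := (c^-1)%:C *: a.
have aE : a = c%:C *: a'.
  by rewrite scalerA -rmorphM/= divff ?scale1r// eq_sym.
have [||h [hs hh h1 hC]] := @sqrt_near_one a'; first by rewrite /a' starZr sa.
  rewrite -(ler_pM2l cp) mulr1; apply: le_trans ac.
  by rewrite -{1}(ger0_norm c0) -rnormZ scalerBr -aE.
exists ((Num.sqrt c)%:C *: h); split.
- by rewrite starZr hs.
- by rewrite -scalerAl -scalerAr hh scalerA -rmorphM/= -expr2 sqr_sqrtr// -aE.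
- rewrite /scal -scalerBr rnormZ ger0_norm ?sqrtr_ge0//.
  by rewrite -[leRHS]mulr1 ler_wpM2l// sqrtr_ge0.
- move=> b ab; rewrite -scalerAl -scalerAr hC//.
  by rewrite /a' -scalerAl -scalerAr ab.
Qed.

Lemma conj_i : ('i%C : R[i])^*%R = - 'i%C.
Proof. by apply/eqP; rewrite eq_complex/= oppr0 !eqxx. Qed.
Lemma mul_ii : ('i%C : R[i]) * 'i%C = -1.
Proof. by rewrite -expr2 sqr_i. Qed.

(** Commuting self-adjoint h and k are the real and imaginary part of a normal
    element; its C*-norm compares h with h^2 + k^2 in the next lemma. *)
Lemma star_cartesian (h k : A) : star h = h -> star k = k -> h * k = k * h ->
  star (h + 'i%C *: k) * (h + 'i%C *: k) = h * h + k * k.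
Proof.
move=> sh sk hk; rewrite starD starZ sh sk conj_i.
rewrite mulrDl !mulrDr scaleNr !mulNr -!scalerAl -!scalerAr hk scalerA.
by rewrite mul_ii scaleN1r opprK addrA addrK.
Qed.

Lemma rnorm_sqr_le (h k : A) : star h = h -> star k = k -> h * k = k * h ->
  rnorm h ^+ 2 <= rnorm (h * h + k * k).
Proof.
move=> sh sk hk; rewrite -star_cartesian// rnorm_starM.
set x := h + _; rewrite ler_sqr ?nnegrE ?rnorm_ge0//.
have e : h + h = x + star x.
  by rewrite /x starD starZ sh sk conj_i scaleNr addrACA subrr addr0.
have : rnorm (h + h) <= rnorm x + rnorm x.
  by rewrite e -[X in _ <= _ + X]rnorm_star rnormD.
have -> : rnorm (h + h) = 2 * rnorm h.
  by rewrite -mulr2n -scaler_nat -(rmorph_nat (real_complex R)) rnormZ normr_nat.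
lra.
Qed.

Lemma pos_star a : pos a -> star a = a.
Proof. by move=> [h hs ->]; rewrite starM hs. Qed.

Lemma pos0 : pos 0.
Proof. by exists 0; rewrite ?star0 ?mul0r. Qed.

Lemma pos_sqrt (c : R) a : star a = a -> 0 <= c -> rnorm (scal c - a) <= c -> pos a.
Proof.
by move=> sa c0 /(sqrt_near_scal c0 sa)[h [sh <- _ _]]; exists h.
Qed.

(** Put k^2 = c - h^2.  As h^2 + k^2 = c, the previous comparison gives
    |k|^2 <= c. *)
Lemma pos_rnorm_sub (c : R) a : pos a -> rnorm a <= c -> rnorm (scal c - a) <= c.
Proof.
move=> [h hs ->] hc; have c0 : 0 <= c by apply: le_trans hc; exact: rnorm_ge0.
have [||k [ks kk _ kC]] := @sqrt_near_scal c (scal c - h * h) c0.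
- by rewrite starB star_scal starM hs.
- by rewrite subKr.
have hk : k * h = h * k by apply: kC; rewrite mulrBl mulrBr scalC mulrA.
rewrite -{1}kk rnorm_sqr// ; apply: le_trans (rnorm_sqr_le ks hs hk) _.
by rewrite kk subrK rnorm_scal.
Qed.

Lemma pos_sqrt_comm a : pos a ->
  exists h, [/\ pos h, h * h = a & forall b, a * b = b * a -> h * b = b * h].
Proof.
move=> pa; have [||| h [sh hh h1 hC]] := @sqrt_near_scal (rnorm a) a.
- exact: rnorm_ge0.
- exact: pos_star.
- exact: pos_rnorm_sub.
by exists h; split=> //; apply: (pos_sqrt sh _ h1); exact: sqrtr_ge0.
Qed.

Lemma posD a b : pos a -> pos b -> pos (a + b).
Proof.
move=> pa pb; apply: (@pos_sqrt (rnorm a + rnorm b)).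
- by rewrite starD !pos_star.
- by rewrite addr_ge0 ?rnorm_ge0.
- rewrite scalD opprD addrACA; apply: le_trans (rnormD _ _) _.
  by apply: lerD; apply: pos_rnorm_sub.
Qed.

Lemma pos_sum I (r : seq I) (P : pred I) (F : I -> A) :
  (forall i, P i -> pos (F i)) -> pos (\sum_(i <- r | P i) F i).
Proof. by move=> h; elim/big_ind: _ => //; [exact: pos0|exact: posD]. Qed.

Lemma pos_scal_sub (c : R) a : star a = a -> rnorm a <= c -> pos (scal c - a).
Proof.
move=> sa ac; apply: (@pos_sqrt c).
- by rewrite starB star_scal sa.
- by apply: le_trans ac; exact: rnorm_ge0.
- by rewrite subKr.
Qed.

(** The square roots h of a and k of c - a commute, and h^2 + k^2 = c. *)
Lemma pos_rnorm_le (c : R) a : 0 <= c -> pos a -> pos (scal c - a) -> rnorm a <= c.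
Proof.
move=> c0 pa pca.
have [h [/pos_star sh hh hC]] := pos_sqrt_comm pa.
have [k [/pos_star sk kk kC]] := pos_sqrt_comm pca.
rewrite -hh rnorm_sqr// -[leRHS](rnorm_scal c0) -(subrK a (scal c)) -kk -hh addrC.
apply: rnorm_sqr_le => //; apply: hC; rewrite -(kC a) //.
by rewrite mulrBl mulrBr scalC.
Qed.

Lemma pos_anti a : pos a -> pos (- a) -> a = 0.
Proof.
move=> pa pna; apply: rnorm0_eq0; apply/eqP; rewrite eq_le rnorm_ge0 andbT.
by apply: pos_rnorm_le => //; rewrite scal0 sub0r.
Qed.

Lemma pos_rnormD a b : pos a -> pos b -> rnorm a <= rnorm (a + b).
Proof.
move=> pa pb; apply: pos_rnorm_le; rewrite ?rnorm_ge0//.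
have -> : scal (rnorm (a + b)) - a = (scal (rnorm (a + b)) - (a + b)) + b.
  by rewrite opprD addrA subrK.
apply: posD => //; apply: pos_scal_sub => //; exact/pos_star/posD.
Qed.

Lemma sa_sqr_eq0 (h : A) : star h = h -> h * h = 0 -> h = 0.
Proof.
move=> sh hh; have := rnorm_sqr sh; rewrite hh rnorm0 => /esym/eqP.
by rewrite sqrf_eq0 => /eqP/rnorm0_eq0.
Qed.

Lemma starM_eq0 x : star x * x = 0 -> x = 0.
Proof.
move=> xx; have := rnorm_starM x; rewrite xx rnorm0 => /esym/eqP.
by rewrite sqrf_eq0 => /eqP/rnorm0_eq0.
Qed.

Lemma cartesian x : exists p q : A, [/\ star p = p, star q = q & x = p + 'i%C *: q].
Proof.
pose hf : R[i] := (2^-1 : R)%:C.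
have hfK (b : A) : hf *: b + hf *: b = b by exact: halfK.
exists (hf *: (x + star x)), (- 'i%C *: (hf *: (x - star x))); split.
- by rewrite starZr starD starK addrC.
- rewrite starZ starZr starB starK rmorphN/= conj_i opprK scaleNr.
  by rewrite -scalerN -scalerN opprB.
- rewrite scalerA mulrN mul_ii opprK scale1r -scalerDr addrACA subrr addr0.
  by rewrite scalerDr hfK.
Qed.

(** Writing y = p + i q with p and q self-adjoint, the sum of the two products is
    2 (p^2 + q^2), which is positive; so each of them is positive as well as
    negative. *)
Lemma neg_starM y : pos (- (star y * y)) -> pos (- (y * star y)) -> y = 0.
Proof.
move=> p1 p2; apply: starM_eq0; apply: (pos_anti _ p1).
have [p [q [sp sq yE]]] := cartesian y.
have E : star y * y + y * star y = (p * p + p * p) + (q * q + q * q).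
  rewrite yE starD starZ conj_i sp sq !mulrDl !mulrDr !scaleNr !mulNr !mulrN.
  rewrite -!scalerAl -!scalerAr !scalerA mul_ii !scaleN1r !opprK.
  rewrite addrACA; congr (_ + _); rewrite addrACA.
    by rewrite subrr addr0.
  by rewrite addNr add0r.
have pE : pos (star y * y + y * star y).
  by rewrite E; apply: posD; apply: posD; [exists p|exists p|exists q|exists q].
have -> : star y * y = (star y * y + y * star y) + - (y * star y) by rewrite addrK.
exact: posD.
Qed.

(** Let a = star(x) x, let b be the positive root of a^2 and k the root of b, and
    put m = b - a, which is twice the negative part of a.  For y = x m one
    finds star(y) y = a m^2 = - (k m)^2 =: - g^2, and then both products of
    y g with its adjoint are negatives of squares.  Hence y g = 0, from which
    g, y and m vanish in turn, and a = b. *)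
Lemma pos_starM x : pos (star x * x).
Proof.
set a := star x * x; have sa : star a = a by rewrite starM starK.
have [|b [pb bb bC]] := @pos_sqrt_comm (a * a); first by exists a.
have ab : b * a = a * b by apply: bC; rewrite mulrA.
have [k [/pos_star sk kk kC]] := pos_sqrt_comm pb.
(* b - a is twice the negative part of a *)
pose m := b - a; have sm : star m = m by rewrite starB pos_star ?sa.
have am : a * m = m * a by rewrite mulrBl mulrBr ab.
have km : k * m = m * k by apply: kC; rewrite mulrBl mulrBr ab.
have abm : a * m = - (b * m).
  by apply/eqP; rewrite -addr_eq0 -mulrDl mulrDl !mulrBr bb -ab subrKA subrr.
pose g := k * m; have sg : star g = g by rewrite starM sk sm -km.
pose y := x * m.
have yy : star y * y = - (g * g).
  rewrite /y starM sm -mulrA (mulrA (star x)) -/a mulrA -am abm mulNr.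
  by rewrite /g -mulrA (mulrA m) -km -(mulrA k) mulrA kk mulrA.
have y'0 : y * g = 0.
  apply: neg_starM.
    exists (g * g); first by rewrite starM sg.
    by rewrite starM sg -(mulrA g) (mulrA (star y) y) yy mulNr mulrN opprK !mulrA.
  exists (y * star y); first by rewrite starM starK.
  rewrite (starM y g) sg -(mulrA y g) (mulrA g g) -[g * g]opprK -yy.
  by rewrite mulNr mulrN opprK !mulrA.
have gg0 : g * g = 0.
  apply: sa_sqr_eq0; first by rewrite starM sg.
  have ggg : g * g * g = 0.
    by rewrite -[g * g]opprK -yy mulNr -(mulrA (star y)) y'0 mulr0 oppr0.
  by rewrite mulrA ggg mul0r.
have y0 : y = 0 by apply: starM_eq0; rewrite yy gg0 oppr0.
have am0 : a * m = 0 by rewrite /a -(mulrA (star x)) -/y y0 mulr0.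
have m0 : m = 0.
  apply: sa_sqr_eq0 => //; rewrite {1}/m mulrBl am0 subr0.
  by apply/eqP; rewrite -oppr_eq0 -abm am0.
by move/eqP: m0; rewrite subr_eq0 => /eqP <-.
Qed.

End Star.

(** * C*-subalgebras and homomorphisms *)

Section Gen.
Variables (R : realType) (A : cstarType R).

(** Let e = p - q.  Then e (p + q) = 0, so that e p e = - e q e is both positive
    and negative, and e^3 = 0. *)
Lemma pos_sqr_inj (p q : A) : pos p -> pos q -> p * q = q * p -> p * p = q * q ->
  p = q.
Proof.
move=> pp pq pqC ppqq; pose e := p - q.
have se : star e = e by rewrite starB !pos_star.
have pos_conj (h : A) : pos h -> pos (e * h * e).
  move=> [k sk ->]; have := pos_starM (k * e).
  by rewrite starM se sk !mulrA.
have e0 : e * (p + q) = 0.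
  by rewrite mulrBl !mulrDr ppqq pqC [X in X - _]addrC subrr.
have epe : e * p * e = - (e * q * e).
  by apply/eqP; rewrite -addr_eq0 -mulrDl -mulrDr e0 mul0r.
have eqe0 : e * q * e = 0.
  by apply: pos_anti; rewrite -?epe; apply: pos_conj.
have eee : e * e * e = 0.
  have -> : e * e * e = e * p * e - e * q * e by rewrite -mulrBl -mulrBr.
  by rewrite epe eqe0 oppr0 addr0.
apply/eqP; rewrite -subr_eq0 -/e; apply/eqP; apply: sa_sqr_eq0 => //.
by apply: sa_sqr_eq0; rewrite ?starM ?se// mulrA eee mul0r.
Qed.

Lemma cstar_gen_sub (X S : set A) : cstar_subalg S -> X `<=` S -> cstar_gen X `<=` S.
Proof. by move=> hS XS; apply: smallest_sub. Qed.

Lemma cstar_gen_subalg (X : set A) : cstar_subalg (cstar_gen X).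
Proof.
split.
- apply/closed_rnormP => x hx S [hS XS].
  have /closed_rnormP clS := Defs.subalg_closed hS; apply: clS => e /hx[y Sy hy].
  by exists y => //; apply: Sy.
- by move=> S [hS XS]; apply: subalg1.
- by move=> x y hx hy S [hS XS]; apply: (subalgD hS); [apply: hx|apply: hy].
- by move=> a x hx S [hS XS]; apply: (Defs.subalgZ hS); apply: hx.
- by move=> x y hx hy S [hS XS]; apply: (subalgM hS); [apply: hx|apply: hy].
- by move=> x hx S [hS XS]; apply: (subalg_star hS); apply: hx.
Qed.

Lemma cstar_gen_gen (X : set A) : X `<=` cstar_gen X.
Proof. exact: sub_smallest. Qed.

(** The commutation with the adjoint of b is what makes this set closed under
    the involution. *)
Lemma cstar_commutant (b : A) :
  cstar_subalg [set a | a * b = b * a /\ a * star b = star b * a].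
Proof.
split=> /=.
- apply/closed_rnormP => x hx.
  by split; apply: commute_limit => e /hx[y [? ?] ?]; exists y.
- by rewrite !mul1r !mulr1.
- by move=> x y [h1 h2] [h3 h4]; rewrite !mulrDl !mulrDr h1 h2 h3 h4.
- by move=> a x [h1 h2]; rewrite -!scalerAl -!scalerAr h1 h2.
- by move=> x y [h1 h2] [h3 h4]; rewrite -!mulrA h3 h4 !mulrA h1 h2.
- by move=> x [h1 h2]; split; apply: (can_inj (@starK _ _)); rewrite !starM !starK.
Qed.

End Gen.

Section Hom.
Variables (R : realType) (A B : cstarType R).

Lemma homD (f : starHom A B) x y : f (x + y) = f x + f y.
Proof. exact: rmorphD. Qed.
Lemma homB (f : starHom A B) x y : f (x - y) = f x - f y.
Proof. exact: rmorphB. Qed.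
Lemma homM (f : starHom A B) x y : f (x * y) = f x * f y.
Proof. exact: rmorphM. Qed.
Lemma hom1 (f : starHom A B) : f 1 = 1.
Proof. exact: rmorph1. Qed.
Lemma homZ (f : starHom A B) a x : f (a *: x) = a *: f x.
Proof. exact: linearZ. Qed.
Lemma hom_star (f : starHom A B) x : f (star x) = star (f x).
Proof. exact: starHomP. Qed.

Lemma hom_pos (f : starHom A B) a : pos a -> pos (f a).
Proof. by move=> [h sh ->]; exists (f h); rewrite -?hom_star ?sh// homM. Qed.

Lemma hom_scal (f : starHom A B) c : f (scal A c) = scal B c.
Proof. by rewrite /scal homZ hom1. Qed.

(** Homomorphisms preserve the inequality star(a) a <= |star(a) a|. *)
Lemma hom_contract (f : starHom A B) a : rnorm (f a) <= rnorm a.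
Proof.
rewrite -ler_sqr ?nnegrE ?rnorm_ge0// -!rnorm_starM -hom_star -homM.
apply: pos_rnorm_le; rewrite ?rnorm_ge0//; first exact/hom_pos/pos_starM.
rewrite -(hom_scal f) -homB; apply: hom_pos; apply: pos_scal_sub => //.
by rewrite starM starK.
Qed.

(** It is enough to bound the norm of a positive a by r, the norm of f(a).  The
    image of d = r - a is positive, so it is the positive root of its own
    square; by injectivity d is the positive root of d^2 as well, that is,
    a <= r. *)
Lemma hom_isometric (f : starHom A B) : injective f ->
  forall a, rnorm (f a) = rnorm a.
Proof.
move=> injf x; apply/eqP; rewrite eq_le hom_contract.
rewrite -ler_sqr ?nnegrE ?rnorm_ge0// -!rnorm_starM -hom_star -homM.
set a := star x * x; have pa : pos a := pos_starM x.
set r := rnorm (f a); have r0 : 0 <= r := rnorm_ge0 _.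
pose d := scal A r - a.
have sd : star d = d by rewrite starB star_scal pos_star.
have [|b [pb bb bC]] := @pos_sqrt_comm _ _ (d * d); first by exists d.
have bd : b = d.
  apply: injf; apply: pos_sqr_inj.
  - exact: hom_pos.
  - have -> : f d = scal B r - f a by rewrite homB; congr (_ - _); exact: hom_scal.
    by apply: pos_scal_sub => //; rewrite -hom_star pos_star.
  - by rewrite -!homM; congr (f _); apply: bC; rewrite mulrA.
  - by rewrite -!homM bb.
by apply: pos_rnorm_le => //; rewrite -/d -bd.
Qed.

Lemma cstar_preimage (f : starHom A B) (S : set B) :
  cstar_subalg S -> cstar_subalg (f @^-1` S).
Proof.
case=> clS S1 SD SZ SM Sst; split=> /=.
- apply/closed_rnormP => x hx; move/closed_rnormP: clS; apply => e /hx[y Sy hy].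
  by exists (f y) => //; apply: le_trans hy; rewrite -homB hom_contract.
- by rewrite hom1.
- by move=> x y Sx Sy; rewrite homD; apply: SD.
- by move=> a x Sx; rewrite homZ; apply: SZ.
- by move=> x y Sx Sy; rewrite homM; apply: SM.
- by move=> x Sx; rewrite hom_star; apply: Sst.
Qed.

Lemma cstar_equalizer (f g : starHom A B) : cstar_subalg [set x | f x = g x].
Proof.
split=> /=.
- apply/closed_rnormP => x hx; apply/eqP; rewrite -subr_eq0; apply/eqP.
  apply: (@rnorm_small_eq0 _ _ _ 2) => e /hx[y /= fgy hy].
  have -> : f x - g x = f (x - y) - g (x - y).
    by rewrite !homB fgy opprB addrA subrK.
  apply: le_trans (rnormB _ _) _.
  by have := hom_contract f (x - y); have := hom_contract g (x - y); lra.
- by rewrite !hom1.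
- by move=> x y h1 h2; rewrite !homD h1 h2.
- by move=> a x h1; rewrite !homZ h1.
- by move=> x y h1 h2; rewrite !homM h1 h2.
- by move=> x h1; rewrite !hom_star h1.
Qed.

Lemma hom_ext (X : set A) (f g : starHom A B) : cstar_gen X = setT ->
  (forall x, X x -> f x = g x) -> forall x, f x = g x.
Proof.
move=> gX fg x; apply: (cstar_gen_sub (cstar_equalizer f g) (X := X)) => //.
by rewrite gX.
Qed.

(** The image of the C*-algebra generated by X is closed: a limit of such images
    lies in the range of f, which is closed by assumption, and f is an
    isometry. *)
Lemma cstar_gen_inj (f : starHom A B) (X : set A) : injective f ->
  range f = cstar_gen (f @` X) -> cstar_gen X = setT.
Proof.
move=> injf rf; apply/seteqP; split=> // x _.
have [clS S1 SD SZ SM Sst] := cstar_gen_subalg X.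
suff : (f @` cstar_gen X) (f x) by case=> y Sy /injf <-.
have : range f (f x) by exists x.
rewrite rf; apply: cstar_gen_sub => [|_ [y Xy <-]]; last first.
  by exists y => //; apply: cstar_gen_gen.
split.
- apply/closed_rnormP => y hy.
  have [z _ zy] : range f y.
    have /closed_rnormP clf := Defs.subalg_closed (cstar_gen_subalg (f @` X)).
    rewrite rf; apply: clf => e /hy[_ [z _ <-] ?].
    by exists (f z) => //; rewrite -rf; exists z.
  exists z => //; move/closed_rnormP: clS => clS; apply: clS => e /hy[_ [t St <-]].
  by rewrite -zy -homB hom_isometric// => ?; exists t.
- by exists 1; rewrite ?hom1.
- by move=> _ _ [y Sy <-] [z Sz <-]; exists (y + z); rewrite ?homD//; apply: SD.
- by move=> a _ [y Sy <-]; exists (a *: y); rewrite ?homZ//; apply: SZ.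
- by move=> _ _ [y Sy <-] [z Sz <-]; exists (y * z); rewrite ?homM//; apply: SM.
- by move=> _ [y Sy <-]; exists (star y); rewrite ?hom_star//; apply: Sst.
Qed.

End Hom.

(** * Matrices over a C*-algebra *)

Lemma posZ (R : realType) (A : cstarType R) (c : R) (a : A) :
  0 <= c -> pos a -> pos (c%:C *: a).
Proof.
move=> c0 [h sh ->]; exists ((Num.sqrt c)%:C *: h); first by rewrite starZr sh.
rewrite -scalerAl -scalerAr scalerA -(rmorphM (real_complex R)).
by rewrite -(expr2 (Num.sqrt c)) sqr_sqrtr.
Qed.

Section HilbertModule.
Variables (R : realType) (B : cstarType R) (n : nat).
Implicit Types (v w : 'I_n.+1 -> B) (x y : 'M[B]_n.+1).

(** The Hilbert module B^(n+1), on which matrices over B act by [mxact]. *)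
Definition inner v w : B := \sum_i star (v i) * w i.
Definition hnorm v : R := Num.sqrt (rnorm (inner v v)).
Definition mxact x v : 'I_n.+1 -> B := fun i => \sum_j x i j * v j.

Lemma inner_pos v : pos (inner v v).
Proof. by apply: pos_sum => i _; exact: pos_starM. Qed.

Lemma hnorm_ge0 v : 0 <= hnorm v.
Proof. exact: sqrtr_ge0. Qed.

Lemma hnorm_sqr v : hnorm v ^+ 2 = rnorm (inner v v).
Proof. by rewrite sqr_sqrtr ?rnorm_ge0. Qed.

Lemma hnorm_entry v i : rnorm (v i) <= hnorm v.
Proof.
rewrite -ler_sqr ?nnegrE ?rnorm_ge0 ?hnorm_ge0// hnorm_sqr -rnorm_starM.
rewrite /inner (bigD1 i)//=; apply: pos_rnormD; first exact: pos_starM.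
by apply: pos_sum => j _; exact: pos_starM.
Qed.

Lemma rnorm_sum I (r : seq I) (P : pred I) (F : I -> B) :
  rnorm (\sum_(i <- r | P i) F i) <= \sum_(i <- r | P i) rnorm (F i).
Proof.
elim/big_rec2: _ => [|i a b _ h]; first by rewrite rnorm0.
by apply: le_trans (rnormD _ _) _; rewrite lerD2l.
Qed.

Lemma hnorm_le_sum v : hnorm v <= \sum_i rnorm (v i).
Proof.
have S0 : 0 <= \sum_i rnorm (v i) by apply: sumr_ge0 => i _; exact: rnorm_ge0.
rewrite -ler_sqr ?nnegrE ?hnorm_ge0// hnorm_sqr.
apply: le_trans (rnorm_sum _ _ _) _; rewrite expr2 mulr_sumr.
apply: ler_sum => i _; rewrite rnorm_starM expr2 ler_wpM2r ?rnorm_ge0//.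
by rewrite (bigD1 i)//= lerDl sumr_ge0// => j _; exact: rnorm_ge0.
Qed.

Lemma inner_star v w : star (inner v w) = inner w v.
Proof. by rewrite star_sum; apply: eq_bigr => i _; rewrite starM starK. Qed.

Lemma innerBl v v' w : inner (fun i => v i - v' i) w = inner v w - inner v' w.
Proof. by rewrite -sumrB; apply: eq_bigr => i _; rewrite starB mulrBl. Qed.
Lemma innerBr v w w' : inner v (fun i => w i - w' i) = inner v w - inner v w'.
Proof. by rewrite -sumrB; apply: eq_bigr => i _; rewrite mulrBr. Qed.
Lemma innerDl v v' w : inner (fun i => v i + v' i) w = inner v w + inner v' w.
Proof. by rewrite -big_split; apply: eq_bigr => i _; rewrite starD mulrDl. Qed.
Lemma innerDr v w w' : inner v (fun i => w i + w' i) = inner v w + inner v w'.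
Proof. by rewrite -big_split; apply: eq_bigr => i _; rewrite mulrDr. Qed.
Lemma innerMl v w c : inner (fun i => v i * c) w = star c * inner v w.
Proof. by rewrite mulr_sumr; apply: eq_bigr => i _; rewrite starM mulrA. Qed.
Lemma innerMr v w c : inner v (fun i => w i * c) = inner v w * c.
Proof. by rewrite mulr_suml; apply: eq_bigr => i _; rewrite mulrA. Qed.
Lemma innerZl v w (a : R) : inner (fun i => a%:C *: v i) w = a%:C *: inner v w.
Proof. by rewrite scaler_sumr; apply: eq_bigr => i _; rewrite starZr scalerAl. Qed.
Lemma innerZr v w (a : R) : inner v (fun i => a%:C *: w i) = a%:C *: inner v w.
Proof. by rewrite scaler_sumr; apply: eq_bigr => i _; rewrite scalerAr. Qed.

Lemma hnorm_eq0 v : hnorm v = 0 -> forall i, v i = 0.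
Proof.
move=> v0 i; apply: rnorm0_eq0; apply/eqP; rewrite eq_le rnorm_ge0 andbT.
by rewrite -v0 hnorm_entry.
Qed.

(** With c the inner product of w and v, and N the squared norm of w, the
    square of N v - w c gives N^2 <v,v> = N star(c) c + (two positive terms).
    The second of them is star(h c) (h c) for a root h of N - <w,w>. *)
Lemma inner_CS v w : rnorm (inner v w) <= hnorm v * hnorm w.
Proof.
rewrite -ler_sqr ?nnegrE ?rnorm_ge0 ?mulr_ge0 ?hnorm_ge0//.
rewrite exprMn !hnorm_sqr -inner_star rnorm_star.
set c := inner w v; set N := rnorm (inner w w).
have N0 : 0 <= N := rnorm_ge0 _.
have [Nz|Nnz] := eqVneq N 0.
  have w0 : hnorm w = 0 by rewrite /hnorm -/N Nz sqrtr0.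
  have -> : c = 0.
    by apply: big1 => i _; rewrite (hnorm_eq0 w0) star0 mul0r.
  by rewrite rnorm0 expr0n/= mulr_ge0 ?rnorm_ge0.
have Np : 0 < N by rewrite lt_def Nnz.
have [h sh hh] : pos (scal B N - inner w w).
  by apply: pos_scal_sub => //; rewrite inner_star.
(* N times the component of v orthogonal to w *)
pose X i : B := N%:C *: v i - w i * c.
have E : (N ^+ 2)%:C *: inner v v =
    N%:C *: (star c * c) + (inner X X + star (h * c) * (h * c)).
  have -> : star (h * c) * (h * c) = N%:C *: (star c * c) - star c * (inner w w * c).
    rewrite starM sh -mulrA (mulrA h) -hh mulrBl mulrBr /scal -scalerAl mul1r.
    by rewrite -scalerAr.
  have -> : inner X X = N%:C *: (N%:C *: inner v v - star c * c)
                     - star c * (N%:C *: c - inner w w * c).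
    rewrite innerBl innerMl innerZl !innerBr !innerMr !innerZr.
    congr (_ *: (_ - _ * _) - _).
    by rewrite /c inner_star.
  rewrite scalerBr scalerA -rmorphM/= -expr2 mulrBr -scalerAr.
  by rewrite subrK addrC subrK.
have := @pos_rnormD _ _ (N%:C *: (star c * c)) (inner X X + star (h * c) * (h * c)).
rewrite -E !rnormZ rnorm_starM !ger0_norm ?exprn_ge0// expr2 -mulrA ler_pM2l//.
rewrite [rnorm (inner v v) * _]mulrC; apply.
  by apply: posZ => //; exact: pos_starM.
by apply: posD; [exact: inner_pos|exact: pos_starM].
Qed.

Lemma hnormD v w : hnorm (fun i => v i + w i) <= hnorm v + hnorm w.
Proof.
rewrite -ler_sqr ?nnegrE ?addr_ge0 ?hnorm_ge0// hnorm_sqr innerDl !innerDr.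
apply: le_trans (rnormD _ _) _.
have h1 := rnormD (inner v v) (inner v w); have h2 := rnormD (inner w v) (inner w w).
have h3 := inner_CS v w; have h4 := inner_CS w v.
have h5 := hnorm_sqr v; have h6 := hnorm_sqr w; nra.
Qed.

Lemma innerC v w (a : R[i]) :
  inner (fun i => a *: v i) (fun i => a *: w i) = (a^* * a) *: inner v w.
Proof.
rewrite scaler_sumr; apply: eq_bigr => i _.
by rewrite starZ -scalerAl -scalerAr scalerA.
Qed.

Lemma hnormZ v (a : R[i]) : hnorm (fun i => a *: v i) = complex.Re `|a| * hnorm v.
Proof.
have a0 : 0 <= complex.Re `|a| by rewrite -lecR RRe_real ?normr_real//; exact: normr_ge0.
apply/eqP; rewrite -(@eqrXn2 _ 2) ?mulr_ge0 ?hnorm_ge0//; apply/eqP.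
rewrite hnorm_sqr innerC exprMn hnorm_sqr /rnorm; apply: complexI.
rewrite rmorphM rmorphXn/= !RRe_real ?normr_real// normrZ normrM norm_conjC.
by rewrite expr2.
Qed.

Definition opnorm x : R := sup [set hnorm (mxact x v) | v in [set v | hnorm v <= 1]].

Lemma mxact_bound x v : hnorm (mxact x v) <= (\sum_i \sum_j rnorm (x i j)) * hnorm v.
Proof.
apply: le_trans (hnorm_le_sum _) _; rewrite mulr_suml; apply: ler_sum => i _.
apply: le_trans (rnorm_sum _ _ _) _; rewrite mulr_suml; apply: ler_sum => j _.
apply: le_trans (rnormM _ _) _; rewrite ler_wpM2l ?rnorm_ge0//; exact: hnorm_entry.
Qed.

Lemma hnorm0 : hnorm (fun=> 0) = 0.
Proof. by rewrite /hnorm /inner big1 ?rnorm0 ?sqrtr0// => i _; rewrite mulr0. Qed.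

Lemma mxact0 x : mxact x (fun=> 0) = fun=> 0.
Proof. by apply/funext => i; rewrite /mxact big1// => j _; rewrite mulr0. Qed.

Lemma opnorm_sup x : has_sup [set hnorm (mxact x v) | v in [set v | hnorm v <= 1]].
Proof.
split; first by exists 0; exists (fun=> 0); rewrite /= ?hnorm0 ?ler01 ?mxact0 ?hnorm0.
exists (\sum_i \sum_j rnorm (x i j)) => _ [v /= v1 <-].
apply: le_trans (mxact_bound _ _) _; rewrite -[leRHS]mulr1 ler_wpM2l//.
by do 2![apply: sumr_ge0 => ? _]; exact: rnorm_ge0.
Qed.

Lemma opnorm_ge0 x : 0 <= opnorm x.
Proof.
apply: (sup_upper_bound (opnorm_sup x)); exists (fun=> 0) => /=.
  by rewrite hnorm0 ler01.
by rewrite mxact0 hnorm0.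
Qed.

Lemma mxactZ x v (a : R[i]) : mxact x (fun i => a *: v i) = fun i => a *: mxact x v i.
Proof.
by apply/funext => i; rewrite /mxact scaler_sumr; apply: eq_bigr => j _; rewrite scalerAr.
Qed.

Lemma opnormP x v : hnorm (mxact x v) <= opnorm x * hnorm v.
Proof.
have [v0|vN0] := eqVneq (hnorm v) 0.
  have -> : v = fun=> 0 by apply/funext => i; exact: hnorm_eq0.
  by rewrite mxact0 hnorm0 mulr0.
have vp : 0 < hnorm v by rewrite lt_def vN0 hnorm_ge0.
have E : complex.Re `|(hnorm v)^-1%:C| = (hnorm v)^-1.
  by rewrite normc_def/= expr0n addr0 sqrtr_sqr ger0_norm ?invr_ge0 ?hnorm_ge0.
(* normalize v *)
rewrite -ler_pdivrMr// mulrC -[X in X * _]E -hnormZ -mxactZ.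
apply: (sup_upper_bound (opnorm_sup x)); exists (fun i => (hnorm v)^-1%:C *: v i) => //=.
by rewrite hnormZ E mulVf.
Qed.

Lemma opnorm_le x (c : R) :
  (forall v, hnorm (mxact x v) <= c * hnorm v) -> 0 <= c -> opnorm x <= c.
Proof.
move=> h c0; apply: ge_sup; first by case: (opnorm_sup x).
move=> _ [v /= v1 <-]; apply: le_trans (h v) _.
by rewrite -[leRHS]mulr1 ler_wpM2l.
Qed.

Lemma opnorm_entry x i j : rnorm (x i j) <= opnorm x.
Proof.
pose e k : B := (k == j)%:R.
have -> : x i j = mxact x e i.
  rewrite /mxact (bigD1 j)//= /e eqxx mulr1 big1 ?addr0// => k /negbTE ->.
  by rewrite mulr0.
apply: le_trans (hnorm_entry _ _) _; apply: le_trans (opnormP _ _) _.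
rewrite -[leRHS]mulr1 ler_wpM2l ?opnorm_ge0//.
rewrite /hnorm /inner (bigD1 j)//= /e eqxx star1 mulr1.
rewrite big1 ?addr0 ?rnorm1 ?sqrtr1// => k /negbTE ->.
by rewrite mulr0.
Qed.

Lemma opnorm_le_entries x : opnorm x <= \sum_i \sum_j rnorm (x i j).
Proof.
apply: opnorm_le; first exact: mxact_bound.
by do 2![apply: sumr_ge0 => ? _]; exact: rnorm_ge0.
Qed.

Lemma opnormD x y : opnorm (x + y) <= opnorm x + opnorm y.
Proof.
apply: opnorm_le; last by rewrite addr_ge0 ?opnorm_ge0.
move=> v; have -> : mxact (x + y) v = fun i => mxact x v i + mxact y v i.
  apply/funext => i; rewrite /mxact -big_split; apply: eq_bigr => j _.
  by rewrite mxE mulrDl.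
by apply: le_trans (hnormD _ _) _; rewrite mulrDl lerD ?opnormP.
Qed.

Lemma mxactM x y v : mxact (x *m y) v = mxact x (mxact y v).
Proof.
apply/funext => i; rewrite /mxact.
under [RHS]eq_bigr do rewrite mulr_sumr.
rewrite exchange_big; apply: eq_bigr => j _ /=.
by rewrite mxE mulr_suml; apply: eq_bigr => k _; rewrite mulrA.
Qed.

Lemma opnormM x y : opnorm (x *m y) <= opnorm x * opnorm y.
Proof.
apply: opnorm_le; last by rewrite mulr_ge0 ?opnorm_ge0.
move=> v; rewrite mxactM; apply: le_trans (opnormP _ _) _.
by rewrite -mulrA ler_wpM2l ?opnorm_ge0// opnormP.
Qed.

Lemma inner_adj x v w : inner (mxact x v) w = inner v (mxact (adjoint_mx x) w).
Proof.
rewrite /inner /mxact; under eq_bigr do rewrite star_sum mulr_suml.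
rewrite exchange_big; apply: eq_bigr => j _ /=; rewrite mulr_sumr.
by apply: eq_bigr => i _; rewrite mxE starM mulrA.
Qed.

Lemma adjoint_mxK x : adjoint_mx (adjoint_mx x) = x.
Proof. by apply/matrixP => i j; rewrite !mxE starK. Qed.

(** By adjunction the squared norm of x v is the norm of <v, star(x) x v>, to
    which Cauchy-Schwarz applies. *)
Lemma opnorm_adjM_ge x : opnorm x ^+ 2 <= opnorm (adjoint_mx x *m x).
Proof.
rewrite -ler_sqrt ?exprn_ge0 ?opnorm_ge0// sqrtr_sqr ger0_norm ?opnorm_ge0//.
apply: opnorm_le => [v|]; last exact: sqrtr_ge0.
rewrite -ler_sqr ?nnegrE ?mulr_ge0 ?sqrtr_ge0// exprMn (sqr_sqrtr (opnorm_ge0 _)).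
rewrite hnorm_sqr inner_adj; apply: le_trans (inner_CS _ _) _.
rewrite -mxactM; have :=
 opnormP (adjoint_mx x *m x) v; have := hnorm_ge0 v; nra.
Qed.

Lemma opnorm_adj_le x : opnorm x <= opnorm (adjoint_mx x).
Proof.
have := opnorm_adjM_ge x; have := opnormM (adjoint_mx x) x.
have := opnorm_ge0 x; have := opnorm_ge0 (adjoint_mx x).
move=> a0; rewrite le_eqVlt => /predU1P[<- //|xp] h1 h2.
by rewrite -(ler_pM2r xp) -expr2; exact: le_trans h2 h1.
Qed.

Lemma opnorm_adjM x : opnorm (adjoint_mx x *m x) = opnorm x ^+ 2.
Proof.
apply/eqP; rewrite eq_le opnorm_adjM_ge andbT expr2.
apply: le_trans (opnormM _ _) _; rewrite ler_wpM2r ?opnorm_ge0//.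
by rewrite -[x in leRHS]adjoint_mxK opnorm_adj_le.
Qed.

End HilbertModule.

(** A type of its own for the matrices normed as operators on the Hilbert module. *)
Definition mxcstar (R : realType) (B : cstarType R) (n : nat) := 'M[B]_n.+1.

Section MatrixCStar.
Variables (R : realType) (B : cstarType R) (n : nat).
Local Notation M := (mxcstar B n).

HB.instance Definition _ := GRing.Zmodule.copy M 'M[B]_n.+1.

Definition mxcstar_scale (a : R[i]) (x : M) : M := map_mx (fun b => a *: b) x.

Lemma mxcstar_scaleA a b x :
  mxcstar_scale a (mxcstar_scale b x) = mxcstar_scale (a * b) x.
Proof. by apply/matrixP => i j; rewrite !mxE scalerA. Qed.
Lemma mxcstar_scale1 : left_id 1 mxcstar_scale.
Proof. by move=> x; apply/matrixP => i j; rewrite !mxE scale1r. Qed.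
Lemma mxcstar_scaleDr : right_distributive mxcstar_scale +%R.
Proof. by move=> a x y; apply/matrixP => i j; rewrite !mxE scalerDr. Qed.
Lemma mxcstar_scaleDl x : {morph mxcstar_scale^~ x : a b / a + b}.
Proof. by move=> a b; apply/matrixP => i j; rewrite !mxE scalerDl. Qed.

HB.instance Definition _ :=
  GRing.Zmodule_isLmodule.Build R[i] M mxcstar_scaleA mxcstar_scale1
    mxcstar_scaleDr mxcstar_scaleDl.

Definition mxcstar_norm (x : M) : R[i] := (opnorm x)%:C.

Lemma mxcstar_normD x y : mxcstar_norm (x + y) <= mxcstar_norm x + mxcstar_norm y.
Proof. by rewrite -rmorphD lecR opnormD. Qed.
Lemma opnorm_scale_le (a : R[i]) (x : M) : opnorm (a *: x) <= complex.Re `|a| * opnorm x.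
Proof.
have a0 : 0 <= complex.Re `|a| by rewrite -lecR RRe_real ?normr_real//; exact: normr_ge0.
apply: opnorm_le => [v|]; last by rewrite mulr_ge0 ?opnorm_ge0.
have -> : mxact (a *: x : M) v = fun i => a *: mxact x v i.
  apply/funext => i; rewrite /mxact scaler_sumr; apply: eq_bigr => j _.
  by rewrite mxE scalerAl.
by rewrite hnormZ -mulrA ler_wpM2l ?opnormP.
Qed.
Lemma mxcstar_normZ (a : R[i]) (x : M) : mxcstar_norm (a *: x) = `|a| * mxcstar_norm x.
Proof.
have E (b : R[i]) : `|b| = (complex.Re `|b|)%:C by rewrite RRe_real ?normr_real.
rewrite /mxcstar_norm E -rmorphM; congr _%:C; apply/eqP.
rewrite eq_le opnorm_scale_le andTb.
have [->|a0] := eqVneq a 0; first by rewrite normr0 mul0r opnorm_ge0.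
have ap : 0 < complex.Re `|a| by rewrite -ltcR -E normr_gt0.
have := opnorm_scale_le a^-1 (a *: x); rewrite scalerA mulVf// scale1r.
have : complex.Re `|a| * complex.Re `|a^-1| = 1.
  have CM (p q : R) : (p * q)%:C = p%:C * q%:C :> R[i] by exact: rmorphM.
  by apply: complexI; rewrite CM -!E -normrM mulfV// normr1.
have := opnorm_ge0 x; have := opnorm_ge0 (a *: x : M); nra.
Qed.

Lemma mxcstar_norm0_eq0 x : mxcstar_norm x = 0 -> x = 0.
Proof.
move/complexI => x0; apply/matrixP => i j; rewrite mxE; apply: rnorm0_eq0.
by apply/eqP; rewrite eq_le rnorm_ge0 andbT -x0 opnorm_entry.
Qed.

HB.instance Definition _ :=
  Lmodule_isNormed.Build R[i] M mxcstar_normD mxcstar_normZ mxcstar_norm0_eq0.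

Lemma mxcstar_normE (x : M) : `|x| = (opnorm x)%:C.
Proof. by []. Qed.

(** The operator norm lies between the maximum and the sum of the norms of the
    entries, so limits are taken entrywise. *)
Lemma mxcstar_complete (F : set_system M) : ProperFilter F -> cauchy F -> cvg F.
Proof.
move=> FF /cauchy_ballP cF.
have cij (i j : 'I_n.+1) : cvg ((fun x : M => x i j) @ F : set_system B).
  apply: cauchy_cvg; apply/cauchy_ballP => e e0.
  have [[P Q] /= [FP FQ] PQ] := cF e e0.
  exists ((fun x : M => x i j) @` P, (fun x : M => x i j) @` Q) => /=.
    by split; [apply: filterS FP|apply: filterS FQ] => x Px; exists x.
  move=> [_ _] /= [[x Px <-] [y Qy <-]].
  have := PQ (x, y) (conj Px Qy); rewrite /= -!ball_normE/= => h.
  apply: le_lt_trans h; rewrite normE mxcstar_normE lecR.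
  by have := opnorm_entry (x - y) i j; rewrite !mxE.
pose L : M := \matrix_(i, j) lim ((fun x : M => x i j) @ F : set_system B).
apply/cvg_ex; exists L; apply/cvg_ballP => e e0.
have er : e = (complex.Re e)%:C by rewrite RRe_real// gtr0_real.
have e1 : 0 < complex.Re e by rewrite -ltcR -er.
(* there are (n+1)^2 entries, and half of e leaves a strict inequality *)
pose d := complex.Re e / 2 / (n.+1 * n.+1)%:R.
have d0 : 0 < d by rewrite !divr_gt0// ltr0n.
have h : \forall x \near F, forall ij : 'I_n.+1 * 'I_n.+1,
    rnorm (L ij.1 ij.2 - (x : M) ij.1 ij.2) <= d.
  apply: filter_forall => -[i j] /=.
  have /cvgrPdist_le /(_ d%:C) := cij i j; rewrite ltcR => /(_ d0).
  by apply: filterS => x; rewrite normE lecR mxE.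
apply: filterS h => x hx; rewrite -ball_normE/= mxcstar_normE er ltcR.
apply: le_lt_trans (opnorm_le_entries _) _.
apply: (@le_lt_trans _ _ (\sum_(i < n.+1) \sum_(j < n.+1) d)).
  apply: ler_sum => i _; apply: ler_sum => j _; have := hx (i, j).
  by rewrite /= !mxE.
rewrite !sumr_const !card_ord -mulrnA -mulr_natr /d divfK ?pnatr_eq0//.
lra.
Qed.

HB.instance Definition _ := Uniform_isComplete.Build M mxcstar_complete.

Definition mxcstar_mul (x y : M) : M := x *m y.
Definition mxcstar_star (x : M) : M := adjoint_mx x.

Lemma mxcstar_mulA : associative mxcstar_mul. Proof. exact: mulmxA. Qed.
Lemma mxcstar_mul1 : left_id (1%:M : M) mxcstar_mul. Proof. exact: mul1mx. Qed.
Lemma mxcstar_mulr1 : right_id (1%:M : M) mxcstar_mul. Proof. exact: mulmx1. Qed.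
Lemma mxcstar_mulDl : left_distributive mxcstar_mul +%R.
Proof. by move=> ? ? ?; exact: mulmxDl. Qed.
Lemma mxcstar_mulDr : right_distributive mxcstar_mul +%R.
Proof. by move=> ? ? ?; exact: mulmxDr. Qed.
Lemma mxcstar_one_neq0 : (1%:M : M) != 0.
Proof. by apply/eqP => /matrixP /(_ 0 0) /eqP; rewrite !mxE eqxx oner_eq0. Qed.
Lemma mxcstar_mulZl (a : R[i]) (x y : M) : a *: mxcstar_mul x y = mxcstar_mul (a *: x) y.
Proof.
apply/matrixP => i j; rewrite !mxE scaler_sumr; apply: eq_bigr => k _.
by rewrite mxE scalerAl.
Qed.
Lemma mxcstar_mulZr (a : R[i]) (x y : M) : a *: mxcstar_mul x y = mxcstar_mul x (a *: y).
Proof.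
apply/matrixP => i j; rewrite !mxE scaler_sumr; apply: eq_bigr => k _.
by rewrite mxE scalerAr.
Qed.
Lemma mxcstar_starK : involutive mxcstar_star. Proof. exact: adjoint_mxK. Qed.
Lemma mxcstar_starD : {morph mxcstar_star : x y / x + y}.
Proof. by move=> x y; apply/matrixP => i j; rewrite !mxE starD. Qed.
Lemma mxcstar_starZ (a : R[i]) (x : M) : mxcstar_star (a *: x) = a^* *: mxcstar_star x.
Proof. by apply/matrixP => i j; rewrite !mxE starZ. Qed.
Lemma mxcstar_starM (x y : M) :
  mxcstar_star (mxcstar_mul x y) = mxcstar_mul (mxcstar_star y) (mxcstar_star x).
Proof. exact: adjoint_mulmx. Qed.
Lemma mxcstar_normM (x y : M) : `|mxcstar_mul x y| <= `|x| * `|y|.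
Proof. by rewrite !mxcstar_normE -rmorphM lecR opnormM. Qed.
Lemma mxcstar_norm_starM (x : M) : `|mxcstar_mul (mxcstar_star x) x| = `|x| ^+ 2.
Proof. by rewrite !mxcstar_normE opnorm_adjM rmorphXn. Qed.

HB.instance Definition _ := isCStar.Build R M mxcstar_mulA mxcstar_mul1 mxcstar_mulr1
  mxcstar_mulDl mxcstar_mulDr mxcstar_one_neq0 mxcstar_mulZl mxcstar_mulZr
  mxcstar_starK mxcstar_starD
  mxcstar_starZ mxcstar_starM mxcstar_normM mxcstar_norm_starM.

End MatrixCStar.

Lemma starHom_intro (R : realType) (A B : cstarType R) (f : A -> B) :
  {morph f : x y / x + y} -> f 1 = 1 -> {morph f : x y / x * y} ->
  (forall (a : R[i]) x, f (a *: x) = a *: f x) -> {morph f : x / star x} ->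
  exists g : starHom A B, forall x, g x = f x.
Proof.
move=> fD f1 fM fZ fS.
have f0 : f 0 = 0 by apply: (addrI (f 0)); rewrite -fD !addr0.
have fB : zmod_morphism f.
  by move=> x y; rewrite fD -scaleN1r fZ scaleN1r.
pose a1 := GRing.isZmodMorphism.Build A B f fB.
pose a2 := GRing.isMonoidMorphism.Build A B f (conj f1 fM).
pose a3 := GRing.isScalable.Build R[i] A B *:%R f fZ.
pose g : {lrmorphism A -> B} := HB.pack f a1 a2 a3.
by exists (@StarHom _ _ _ g fS).
Qed.

Section SqrtExtension.
Variables (R : realType) (B : cstarType R).

(** In the 2 x 2 matrices over B the square of the matrix with rows (0 t) and
    (1 0) is the scalar matrix t, and this matrix commutes with the scalar
    matrix b as soon as b commutes with t.  E reads off the entry (0, 0); it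
    detects the image of B inside the extension. *)
Lemma sqrt_extension (t : B) : t * star t = 1 -> star t * t = 1 ->
  exists (D : cstarType R) (e : starHom B D) (E : D -> B) (z : D),
    [/\ cancel e E, forall x y, rnorm (E x - E y) <= rnorm (x - y),
        z * star z = 1 /\ star z * z = 1, z * z = e t
      & forall b, b * t = t * b -> e b * z = z * e b].
Proof.
move=> tt' t't; pose D : cstarType R := mxcstar B 1.
have normD (x : D) : rnorm x = opnorm (x : 'M[B]_2) by [].
have mulD (x y : D) : x * y = (x : 'M[B]_2) *m (y : 'M[B]_2) by [].
have starD_ (x : D) : star x = adjoint_mx (x : 'M[B]_2) by [].
have oneD : 1 = 1%:M :> D by [].
have scaleD (a : R[i]) (x : D) : a *: x = map_mx (fun b => a *: b) (x : 'M[B]_2) by [].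
have [||||| e eE] := @starHom_intro _ B D (fun b => b%:M : 'M[B]_2).
- by move=> x y; apply/matrixP => i j; rewrite !mxE mulrnDl.
- by [].
- by move=> x y; rewrite mulD scalar_mxM.
- move=> a x; rewrite scaleD; apply/matrixP => i j; rewrite !mxE.
  by case: eqP => _; rewrite ?mulr0n ?scaler0.
- move=> x; rewrite starD_; apply/matrixP => i j; rewrite !mxE eq_sym.
  by case: eqP => _; rewrite ?mulr0n ?star0.
pose zm : 'M[B]_2 := \matrix_(i, j) if i == 0 then (if j == 0 then 0 else t)
                                   else (if j == 0 then 1 else 0).
exists D, e, (fun x => (x : 'M[B]_2) 0 0), zm.
have I2 (P : 'I_2 -> Prop) : P ord0 -> P (lift ord0 ord0) -> forall i, P i.
  by move=> P0 P1 i; case: (unliftP ord0 i) => [j ->|->//]; rewrite ord1.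
split=> //.
- by move=> b; rewrite eE mxE eqxx.
- move=> x y; rewrite normD; apply: le_trans (opnorm_entry _ 0 0).
  by rewrite !mxE.
- rewrite starD_ oneD !mulD; split; apply/matrixP; apply: (@I2 _); apply: (@I2 _);
    rewrite !mxE !big_ord_recl !big_ord0 !mxE /= ?star0 ?star1;
    rewrite ?mulr0 ?mul0r ?mulr1 ?addr0 ?add0r //.
- rewrite eE mulD; apply/matrixP; apply: (@I2 _); apply: (@I2 _);
    rewrite !mxE !big_ord_recl !big_ord0 !mxE /=;
    rewrite ?mulr0 ?mul0r ?mulr1 ?mul1r ?addr0 ?add0r //.
- move=> b bt; rewrite eE !mulD; apply/matrixP; apply: (@I2 _); apply: (@I2 _);
    rewrite !mxE !big_ord_recl !big_ord0 !mxE /= ?mulr0n ?mulr1n;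
    rewrite ?mulr0 ?mul0r ?mulr1 ?mul1r ?addr0 ?add0r //.
Qed.

End SqrtExtension.

(** * Partitions and the functions constant on their blocks *)

Definition fcomp n k l (h : 'I_l -> 'I_k) (g : {ffun 'I_k -> 'I_n}) :
  {ffun 'I_l -> 'I_n} := [ffun x => g (h x)].

Definition fcat n k l (a : {ffun 'I_k -> 'I_n}) (b : {ffun 'I_l -> 'I_n}) :
  {ffun 'I_(k + l) -> 'I_n} :=
  [ffun x => match fintype.split x with inl y => a y | inr y => b y end].

Lemma fcat_lshift n k l (a : {ffun 'I_k -> 'I_n}) (b : {ffun 'I_l -> 'I_n}) :
  fcomp (@lshift k l) (fcat a b) = a.
Proof.
by apply/ffunP => x; rewrite !ffunE -[lshift l x]/(unsplit (inl x)) unsplitK.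
Qed.

Lemma fcat_rshift n k l (a : {ffun 'I_k -> 'I_n}) (b : {ffun 'I_l -> 'I_n}) :
  fcomp (@rshift k l) (fcat a b) = b.
Proof.
by apply/ffunP => x; rewrite !ffunE -[rshift k x]/(unsplit (inr x)) unsplitK.
Qed.

Lemma color_tensl k l (p : cpart k) (q : cpart l) x :
  color (ptens p q) (lshift l x) = color p x.
Proof. by rewrite ffunE -[lshift l x]/(unsplit (inl x)) unsplitK. Qed.
Lemma color_tensr k l (p : cpart k) (q : cpart l) x :
  color (ptens p q) (rshift k x) = color q x.
Proof. by rewrite ffunE -[rshift k x]/(unsplit (inr x)) unsplitK. Qed.
Lemma color_reflect k (p : cpart k) x : color (preflect p) x = ~~ color p (rev_ord x).
Proof. exact: ffunE. Qed.
Lemma color_rotate k (p : cpart k) x : color (protate p) x = color p (ord_pred x).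
Proof. exact: ffunE. Qed.
Lemma color_contract k i (p : cpart k.+2) x :
  color (pcontract i p) x = color p (skip2 i x).
Proof. exact: ffunE. Qed.
Lemma color_sqcap a b x : color (sqcap a b) x = if x == ord0 then a else b.
Proof. exact: ffunE. Qed.

Section Delta.
Variable n : nat.

(** The functions constant on the blocks, in terms of the equivalence relation of
    lying in the same block, which is how all the operations are given. *)
Lemma deltaP k (p : cpart k) (f : {ffun 'I_k -> 'I_n}) :
  reflect (forall x y, block p x = block p y -> f x = f y) (delta p f).
Proof.
have /and3P[/eqP cov tI _] := blocksP p.
have inc x : x \in finset.cover (blocks p) by rewrite cov inE.
apply: (iffP idP) => [/forall_inP h x y bxy|h].
  have /forall_inP /(_ x) := h _ (pblock_mem (inc x)); rewrite mem_pblock => /(_ (inc x)).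
  move/forall_inP => /(_ y); rewrite -/(block p x) bxy mem_pblock => /(_ (inc y)).
  by move/eqP.
apply/forall_inP => B BP; apply/forall_inP => x xB; apply/forall_inP => y yB.
by apply/eqP; apply: h; rewrite /block (def_pblock tI BP xB) (def_pblock tI BP yB).
Qed.

Lemma block_fibre k (T : eqType) (f : 'I_k -> T) c x y :
  (block (fibre_part f c) x == block (fibre_part f c) y) = (f x == f y).
Proof.
rewrite /block /fibre_part/=.
have /and3P[/eqP cov tI _] := preim_partitionP f [set: 'I_k]%SET.
rewrite eq_pblock ?cov ?inE// pblock_equivalence_partition ?inE//.
by split=> // /eqP ->.
Qed.

Lemma delta_fibreP k (T : eqType) (f : 'I_k -> T) c (g : {ffun 'I_k -> 'I_n}) :
  reflect (forall x y, f x = f y -> g x = g y) (delta (fibre_part f c) g).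
Proof.
apply: (iffP (deltaP _ _)) => h x y.
  by move=> fxy; apply: h; apply/eqP; rewrite block_fibre fxy.
by move=> /eqP; rewrite block_fibre => /eqP; apply: h.
Qed.

Lemma delta_const k (p : cpart k) c : delta p [ffun=> c : 'I_n].
Proof. by apply/deltaP => x y _; rewrite !ffunE. Qed.

Lemma delta_tens k l (p : cpart k) (q : cpart l) (g : {ffun 'I_(k + l) -> 'I_n}) :
  delta (ptens p q) g =
  delta p (fcomp (@lshift k l) g) && delta q (fcomp (@rshift k l) g).
Proof.
apply/delta_fibreP/andP => [h|[/deltaP h1 /deltaP h2] x y].
  split; apply/deltaP => x y bxy; rewrite !ffunE; apply: h.
    rewrite -[lshift l x]/(unsplit (inl x)) -[lshift l y]/(unsplit (inl y)).
    by rewrite !unsplitK bxy.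
  rewrite -[rshift k x]/(unsplit (inr x)) -[rshift k y]/(unsplit (inr y)).
  by rewrite !unsplitK bxy.
move: (splitK x) (splitK y).
case: (fintype.split x) => a; case: (fintype.split y) => b //= <- <- [].
  by move=> /h1; rewrite !ffunE.
by move=> /h2; rewrite !ffunE.
Qed.

Lemma delta_reflect k (p : cpart k) (g : {ffun 'I_k -> 'I_n}) :
  delta (preflect p) g = delta p (fcomp (@rev_ord k) g).
Proof.
apply/delta_fibreP/deltaP => h x y; last by move/h; rewrite !ffunE !rev_ordK.
by move=> bxy; rewrite !ffunE; apply: h; rewrite !rev_ordK.
Qed.

Lemma delta_rotate k (p : cpart k) (g : {ffun 'I_k -> 'I_n}) :
  delta (protate p) g = delta p (fcomp (@ordS k) g).
Proof.
apply/delta_fibreP/deltaP => h x y; last by move/h; rewrite !ffunE !ord_predK.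
by move=> bxy; rewrite !ffunE; apply: h; rewrite !ordSK.
Qed.

Lemma delta_sqcap a b (g : {ffun 'I_2 -> 'I_n}) :
  delta (sqcap a b) g = (g ord0 == g ord_max).
Proof.
apply/delta_fibreP/eqP => [h|h x y _]; first exact: h.
have E z : g z = g ord0.
  by case: (unliftP ord0 z) => [j ->|->//]; rewrite ord1 h; congr (g _); apply: val_inj.
by rewrite !E.
Qed.

End Delta.

(** * The partition relations under the category operations *)

Section Rho.
Variables (R : realType) (A : cstarType R) (n : nat) (u : 'M[A]_n).

(** The vector of p transported by u: the relation of p says that it is the
    vector of p again. *)
Definition rho k (p : cpart k) (b : {ffun 'I_k -> 'I_n}) : A :=
  \sum_(g : {ffun 'I_k -> 'I_n} | delta p g)
    \prod_(x < k) colored u (color p x) (b x) (g x).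

Lemma part_relE k (p : cpart k) :
  part_rel u p <-> forall b, rho p b = (delta p b)%:R.
Proof.
have E (b : {ffun 'I_k -> 'I_n}) : \sum_(ga : {ffun 'I_k -> 'I_n}) (delta p ga)%:R *
    \prod_(x < k) colored u (color p x) (b x) (ga x) = rho p b.
  rewrite /rho [RHS]big_mkcond; apply: eq_bigr => g _.
  by case: (delta p g); rewrite ?mul1r ?mul0r.
by split=> h b; have := h b; rewrite ?E => ->.
Qed.

Lemma sum_fcat k l (F : {ffun 'I_k -> 'I_n} -> {ffun 'I_l -> 'I_n} -> A)
  (P : pred {ffun 'I_k -> 'I_n}) (Q : pred {ffun 'I_l -> 'I_n}) :
  \sum_(g : {ffun 'I_(k + l) -> 'I_n} |
       P (fcomp (@lshift k l) g) && Q (fcomp (@rshift k l) g))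
      F (fcomp (@lshift k l) g) (fcomp (@rshift k l) g) =
  \sum_(a | P a) \sum_(b | Q b) F a b.
Proof.
rewrite pair_big /=.
rewrite (reindex (fun ab => fcat ab.1 ab.2)) /=.
  by apply: eq_big => ab; rewrite fcat_lshift fcat_rshift.
exists (fun g => (fcomp (@lshift k l) g, fcomp (@rshift k l) g)) => [ab _|g _].
  by rewrite fcat_lshift fcat_rshift -surjective_pairing.
apply/ffunP => x; rewrite ffunE -{2}(splitK x).
by case: (fintype.split x) => y; rewrite ffunE.
Qed.

Lemma rho_tens k l (p : cpart k) (q : cpart l) b :
  rho (ptens p q) b = rho p (fcomp (@lshift k l) b) * rho q (fcomp (@rshift k l) b).
Proof.
rewrite /rho mulr_suml; under [RHS]eq_bigr do rewrite mulr_sumr.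
rewrite -(sum_fcat (fun a c =>
  (\prod_(x < k) colored u (color p x) (fcomp (@lshift k l) b x) (a x)) *
  (\prod_(x < l) colored u (color q x) (fcomp (@rshift k l) b x) (c x)))).
apply: eq_big => [g|g _].
  by rewrite delta_tens.
rewrite big_split_ord/=; congr (_ * _); apply: eq_bigr => x _;
  rewrite [fcomp _ b _]ffunE [fcomp _ g _]ffunE.
  by rewrite color_tensl.
by rewrite color_tensr.
Qed.

Lemma star_prod k (F : 'I_k -> A) :
  star (\prod_(x < k) F x) = \prod_(x < k) star (F (rev_ord x)).
Proof.
elim: k F => [|k IHk] F; first by rewrite !big_ord0 star1.
rewrite big_ord_recr big_ord_recl/= starM IHk; congr (star (F _) * _).
  by apply: val_inj; rewrite /= subn1.
apply: eq_bigr => x _; congr (star (F _)); apply: val_inj => /=.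
by rewrite /bump/=; lia.
Qed.

Lemma colored_neg s a b : colored u (~~ s) a b = star (colored u s a b).
Proof. by case: s; rewrite /colored//= starK. Qed.

Lemma sum_fcomp k (h h' : 'I_k -> 'I_k) (P : pred {ffun 'I_k -> 'I_n}) F :
  cancel h h' -> cancel h' h ->
  \sum_(g : {ffun 'I_k -> 'I_n} | P (fcomp h g)) F g =
  \sum_(g | P g) F (fcomp h' g) :> A.
Proof.
move=> hK h'K.
have K1 g : fcomp h (fcomp h' g) = g by apply/ffunP => x; rewrite !ffunE hK.
have K2 g : fcomp h' (fcomp h g) = g by apply/ffunP => x; rewrite !ffunE h'K.
rewrite (reindex (fcomp h')) /=; first by apply: eq_bigl => g; rewrite K1.
by exists (fcomp h) => g _.
Qed.

Lemma rho_reflect k (p : cpart k) b :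
  rho (preflect p) b = star (rho p (fcomp (@rev_ord k) b)).
Proof.
rewrite /rho star_sum (eq_bigl (fun g => delta p (fcomp (@rev_ord k) g))); last first.
  by move=> g; rewrite delta_reflect.
rewrite (sum_fcomp (h' := @rev_ord k) (delta p) _ (@rev_ordK k) (@rev_ordK k)).
apply: eq_bigr => g _; rewrite star_prod; apply: eq_bigr => x _.
by rewrite color_reflect colored_neg !ffunE !rev_ordK.
Qed.

Lemma rho_sqcap s t b :
  rho (sqcap s t) b = \sum_c colored u s (b ord0) c * colored u t (b ord_max) c.
Proof.
rewrite /rho (reindex (fun c => [ffun=> c])) /=; last first.
  exists (fun g => g ord0) => [c _|g]; first by rewrite ffunE.
  rewrite inE delta_sqcap => /eqP h; apply/ffunP => x; rewrite ffunE.
  by case: (unliftP ord0 x) => [j ->|->//]; rewrite ord1 h; congr (g _); apply: val_inj.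
apply: eq_big => [c|c _]; first by rewrite delta_const.
rewrite !big_ord_recl big_ord0 mulr1 !color_sqcap !ffunE; congr (_ * colored _ _ (b _) _).
by apply: val_inj.
Qed.

End Rho.

Section Contract.
Variables (k : nat) (i : 'I_k.+2).
Hypothesis imax : i != ord_max.

Lemma imax_lt : (i < k.+1)%N.
Proof. by have := ltn_ord i; move: imax; rewrite -(inj_eq (@ord_inj _)) /=; lia. Qed.

Lemma val_skip2 (x : 'I_k) : skip2 i x = (if (x < i)%N then x : nat else x.+2) :> nat.
Proof.
rewrite /skip2 (negbTE imax) inordK//; have := ltn_ord x; case: ifP; lia.
Qed.

Lemma val_ordS : ordS i = i.+1 :> nat.
Proof. by rewrite /= modn_small// ltnS imax_lt. Qed.

Lemma skip2_neq x : (skip2 i x != i) * (skip2 i x != ordS i).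
Proof.
by split; rewrite -(inj_eq (@ord_inj _)) ?val_ordS val_skip2; case: ifP; lia.
Qed.

Lemma skip2_inj : injective (skip2 i).
Proof.
move=> x y /(congr1 (@nat_of_ord _)); rewrite !val_skip2 => h; apply: ord_inj.
by move: h; do 2!case: ifP; lia.
Qed.

Lemma skip2_surj (y : 'I_k.+2) : y != i -> y != ordS i -> exists x, y = skip2 i x.
Proof.
rewrite -!(inj_eq (@ord_inj _)) val_ordS => /eqP/= h1 /eqP/= h2.
have hi := imax_lt; have hy := ltn_ord y.
have lt : ((if (y < i)%N then y : nat else y.-2) < k)%N by case: ifP; lia.
exists (Ordinal lt); apply: ord_inj; rewrite val_skip2 /=.
by case: (ltnP y i) => h; [rewrite h|case: ifP]; lia.
Qed.

Variable n : nat.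

(** Points i and i + 1 get the common value c.  These are the functions that
    survive the summation over a contracted pair. *)
Definition insert2 (a : {ffun 'I_k -> 'I_n}) (c : 'I_n) : {ffun 'I_k.+2 -> 'I_n} :=
  [ffun y => if [pick x | y == skip2 i x] is Some x then a x else c].

Lemma insert2_skip a c x : insert2 a c (skip2 i x) = a x.
Proof.
rewrite ffunE; case: pickP => [y /eqP /skip2_inj ->//|/(_ x)].
by rewrite eqxx.
Qed.
Lemma insert2_i a c : insert2 a c i = c.
Proof.
rewrite ffunE; case: pickP => [y|//].
by rewrite eq_sym (negbTE (skip2_neq y).1).
Qed.
Lemma insert2_S a c : insert2 a c (ordS i) = c.
Proof.
rewrite ffunE; case: pickP => [y|//].
by rewrite eq_sym (negbTE (skip2_neq y).2).
Qed.

Lemma sum_insert2 (V : nmodType) (F : {ffun 'I_k.+2 -> 'I_n} -> V)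
  (P : pred {ffun 'I_k.+2 -> 'I_n}) :
  \sum_(g | P g && (g i == g (ordS i))) F g =
  \sum_a \sum_(c | P (insert2 a c)) F (insert2 a c).
Proof.
rewrite pair_big_dep /=.
rewrite (reindex_onto (fun ac => insert2 ac.1 ac.2) (fun g => (fcomp (skip2 i) g, g i))).
  apply: eq_big => [[a c]|//] /=; rewrite insert2_i insert2_S eqxx andbT.
  rewrite (_ : _ == _); first by rewrite andbT.
  by apply/eqP; congr pair; apply/ffunP => x; rewrite ffunE insert2_skip.
move=> g /andP[_ /eqP gi]; apply/ffunP => y.
have [->|yi] := eqVneq y i; first by rewrite insert2_i.
have [->|yS] := eqVneq y (ordS i); first by rewrite insert2_S.
by have [x ->] := skip2_surj yi yS; rewrite insert2_skip ffunE.
Qed.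

Variable p : cpart k.+2.

(** The blocks of i and i + 1 become one block of the contraction, on whose
    remaining points the function must take the value c. *)
Lemma delta_insert2 a c : delta p (insert2 a c) = delta (pcontract i p) a &&
  [forall x, (block p (skip2 i x) \in [:: block p i; block p (ordS i)]) ==> (a x == c)].
Proof.
apply/deltaP/andP => [h|[/delta_fibreP h1 /forall_inP h2]].
  have hx x : block p (skip2 i x) \in [:: block p i; block p (ordS i)] -> a x = c.
    rewrite !inE => /orP[] /eqP /h; rewrite insert2_skip ?insert2_i ?insert2_S//.
  split; last by apply/forall_inP => x /hx ->.
  apply/delta_fibreP => x y.
  case: ifP => [/eqP ex|_]; case: ifP => [/eqP ey|_] e.
  - by rewrite !hx// !inE ?ex ?ey eqxx orbT.
  - by rewrite !hx// !inE ?ex -?e eqxx ?orbT.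
  - by rewrite !hx// !inE ?ey ?e eqxx ?orbT.
  - by have := h _ _ e; rewrite !insert2_skip.
have H y : block p y \in [:: block p i; block p (ordS i)] -> insert2 a c y = c.
  have [->|yi] := eqVneq y i; first by rewrite insert2_i.
  have [->|yS] := eqVneq y (ordS i); first by rewrite insert2_S.
  by have [x ->] := skip2_surj yi yS; rewrite insert2_skip => /h2 /eqP.
move=> y z byz; have [by_|nby] := boolP (block p y \in [:: block p i; block p (ordS i)]).
  by rewrite (H y by_) H// -byz.
have yi : y != i by apply: contraNneq nby => ->; rewrite inE eqxx.
have yS : y != ordS i by apply: contraNneq nby => ->; rewrite !inE eqxx orbT.
have zi : z != i by apply: contraNneq nby => e; rewrite byz e inE eqxx.
have zS : z != ordS i by apply: contraNneq nby => e; rewrite byz e !inE eqxx orbT.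
have [x ex] := skip2_surj yi yS; have [x' ex'] := skip2_surj zi zS.
rewrite ex ex' !insert2_skip; apply: h1; rewrite -ex -ex' -byz.
by move: nby; rewrite !inE negb_or => /andP[_ /negbTE ->].
Qed.

(** The factor produced by a contraction: n when the two points form a union of
    blocks, which then disappears, and 1 when the value c is determined by the
    points that remain. *)
Definition loops : nat :=
  if [exists x, block p (skip2 i x) \in [:: block p i; block p (ordS i)]] then 1%N else n.

Lemma card_insert2 a :
  #|[pred c | delta p (insert2 a c)]| = (loops * delta (pcontract i p) a)%N.
Proof.
rewrite /loops; case: (boolP (delta _ a)) => da; last first.
  by rewrite muln0; apply: eq_card0 => c; rewrite inE delta_insert2 (negbTE da).
rewrite muln1; case: ifP => [/existsP[x0 hx0]|/negbT/existsPn h].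
  rewrite -(card1 (a x0)); apply: eq_card => c; rewrite !inE delta_insert2 da/=.
  apply/forall_inP/eqP => [/(_ _ hx0)/eqP -> //|-> x hx].
  apply/eqP; move/delta_fibreP: da; apply.
  by move: hx hx0; rewrite !inE => /orP[]/eqP -> /orP[]/eqP ->; rewrite ?eqxx;
    do ?case: eqP.
rewrite -[RHS]card_ord; apply: eq_card => c; rewrite !inE delta_insert2 da/=.
by apply/forall_inP => x hx; have := h x; rewrite hx.
Qed.

Lemma loops_gt0 : (0 < n)%N -> (0 < loops)%N.
Proof. by rewrite /loops; case: ifP. Qed.

End Contract.

Section Closure.
Variables (R : realType) (A : cstarType R) (n : nat) (u : 'M[A]_n).
Hypothesis hu : Uplus_rel u.

Lemma colored_row s a b :
  \sum_c colored u s a c * star (colored u s b c) = (a == b)%:R.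
Proof.
case: hu => [[h1 _] [_ h4]]; case: s; rewrite /colored/=.
  have /matrixP /(_ a b) := h1; rewrite !mxE => <-.
  by apply: eq_bigr => c _; rewrite mxE.
have /matrixP /(_ a b) := h4; rewrite !mxE => <-.
by apply: eq_bigr => c _; rewrite !mxE starK.
Qed.

Lemma colored_col s a b :
  \sum_c colored u s c a * star (colored u s c b) = (a == b)%:R.
Proof.
case: hu => [[_ h2] [h3 _]]; case: s; rewrite /colored/=.
  have /matrixP /(_ a b) := h3; rewrite !mxE => <-.
  by apply: eq_bigr => c _; rewrite !mxE.
have /matrixP /(_ a b) := h2; rewrite !mxE => <-.
by apply: eq_bigr => c _; rewrite !mxE starK.
Qed.

Definition set_last k (b : {ffun 'I_k.+1 -> 'I_n}) c : {ffun 'I_k.+1 -> 'I_n} :=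
  [ffun x => if x == ord_max then c else b x].

(** Multiply the relation of p by the adjoint of the last factor and sum over the
    last index: this removes the last factor.  Then multiply by the same
    factor on the left.  The scalar r of the hypothesis ends up between the
    two factors; it is 1 for the relation itself, and [split_choose_sign] uses
    another r, to prove that it is central. *)
Lemma rho_rotate k (p : cpart k.+1) (r : A) b :
  (forall b, rho u p b = (delta p b)%:R * r) ->
  rho u (protate p) b =
  \sum_(c | delta p (set_last (fcomp (@ordS k.+1) b) c))
    \sum_d colored u (color p ord_max) (b ord0) d * r *
      star (colored u (color p ord_max) c d).
Proof.
move=> hr; set b' := fcomp _ b; set s := color p ord_max.
(* the product of all factors but the last *)
pose W (g : {ffun 'I_k.+1 -> 'I_n}) := \prod_(x < k)
  colored u (color p (widen_ord (leqnSn k) x)) (b' (widen_ord (leqnSn k) x))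
    (g (widen_ord (leqnSn k) x)).
have E1 c : rho u p (set_last b' c) =
    \sum_(g | delta p g) W g * colored u s c (g ord_max).
  apply: eq_bigr => g _; rewrite big_ord_recr/=; congr (_ * _); last first.
    by rewrite ffunE eqxx.
  apply: eq_bigr => x _; congr colored; rewrite ffunE ifN//.
  by rewrite -(inj_eq (@ord_inj _))/= neq_ltn ltn_ord.
have E2 : rho u (protate p) b =
    \sum_(g | delta p g) colored u s (b ord0) (g ord_max) * W g.
  rewrite /rho (eq_bigl (fun g => delta p (fcomp (@ordS k.+1) g))); last first.
    by move=> g; rewrite delta_rotate.
  rewrite (sum_fcomp (delta p) _ (@ordSK k.+1) (@ord_predK k.+1)).
  apply: eq_bigr => g _; rewrite big_ord_recl color_rotate ffunE.
  have e0 : ord_pred (ord0 : 'I_k.+1) = ord_max by apply: val_inj; rewrite /= modn_small.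
  rewrite e0; congr (_ * _); apply: eq_bigr => x _; rewrite color_rotate !ffunE.
  have eS : ord_pred (lift ord0 x) = widen_ord (leqnSn k) x.
    apply: ord_inj; rewrite -[LHS]/((lift ord0 x + k.+1).-1 %% k.+1)%N lift0.
    rewrite addSn [_.-1]/= modnDr modn_small//.
    by have := ltn_ord x; lia.
  by rewrite eS -eS ord_predK eS.
rewrite E2 exchange_big/=.
transitivity (\sum_d colored u s (b ord0) d *
    (\sum_c rho u p (set_last b' c) * star (colored u s c d))).
  under [RHS]eq_bigr => d _.
    under eq_bigr => c _ do rewrite E1 mulr_suml.
    rewrite exchange_big/=.
    under eq_bigr => g _.
      under eq_bigr => c _ do rewrite -mulrA.
      rewrite -mulr_sumr colored_col.
      over.
    rewrite mulr_sumr.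
    over.
  rewrite exchange_big/=; apply: eq_bigr => g _.
  rewrite (bigD1 (g ord_max))//= eqxx mulr1 big1 ?addr0// => d /negbTE dg.
  by rewrite eq_sym dg !mulr0.
apply: eq_bigr => d _; rewrite mulr_sumr [RHS]big_mkcond; apply: eq_bigr => c _.
by rewrite hr; case: (delta p _); rewrite ?mul1r ?mul0r ?mulr0 ?mulrA.
Qed.

Lemma part_rel_ext k (p q : cpart k) : color p =1 color q ->
  (forall g : {ffun 'I_k -> 'I_n}, delta p g = delta q g) -> part_rel u p -> part_rel u q.
Proof.
move=> cpq dpq /part_relE h; apply/part_relE => b; rewrite -dpq -h /rho.
apply: eq_big => [g|g _]; first by rewrite dpq.
by apply: eq_bigr => x _; rewrite cpq.
Qed.

Lemma part_rel_rotate k (p : cpart k) : part_rel u p -> part_rel u (protate p).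
Proof.
case: k p => [|k] p h.
  apply: part_rel_ext h => [[]//|g]; rewrite delta_rotate; congr delta.
  by apply/ffunP => -[].
move: h => /part_relE h; apply/part_relE => b.
rewrite (@rho_rotate _ _ 1); last by move=> b'; rewrite mulr1.
under eq_bigr => c _.
  under eq_bigr => d _ do rewrite mulr1.
  rewrite colored_row.
  over.
rewrite delta_rotate.
have e0 : set_last (fcomp (@ordS k.+1) b) (b ord0) = fcomp (@ordS k.+1) b.
  apply/ffunP => x; rewrite ffunE; case: eqP => [->|//]; rewrite ffunE.
  by congr (b _); apply: val_inj; rewrite /= modnn.
rewrite big_mkcond (bigD1 (b ord0))//= e0 eqxx big1 => [|c /negbTE cb].
  by rewrite addr0; case: (delta p _).
by rewrite eq_sym cb; case: ifP.
Qed.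

Lemma part_rel_tens k l (p : cpart k) (q : cpart l) :
  part_rel u p -> part_rel u q -> part_rel u (ptens p q).
Proof.
move=> /part_relE hp /part_relE hq; apply/part_relE => b.
by rewrite rho_tens hp hq delta_tens -natrM mulnb.
Qed.

Lemma part_rel_reflect k (p : cpart k) : part_rel u p -> part_rel u (preflect p).
Proof.
move=> /part_relE hp; apply/part_relE => b.
by rewrite rho_reflect hp star_nat delta_reflect.
Qed.

Lemma mulrn_inj_alg (x y : A) N : (0 < N)%N -> x *+ N = y *+ N -> x = y.
Proof.
move=> N0 h; have NN : (N%:R : R[i]) != 0 by rewrite pnatr_eq0 -lt0n.
by apply: (scalerI NN); rewrite !scaler_nat.
Qed.

(** Extending the factors to all natural numbers allows the product to be cut at
    the contracted pair. *)
Definition onat k (G : 'I_k -> A) (x : nat) : A := oapp G 1 (insub x).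

Lemma onat_ord k (G : 'I_k -> A) (x : 'I_k) : onat G x = G x.
Proof. by rewrite /onat valK. Qed.

Lemma prod_onat k (G : 'I_k -> A) : \prod_(x < k) G x = \prod_(0 <= x < k) onat G x.
Proof. by rewrite big_mkord; apply: eq_bigr => x _; rewrite onat_ord. Qed.

Lemma prod_skip2 k (i : 'I_k.+2) (F : 'I_k.+2 -> A) (G : 'I_k -> A) : i != ord_max ->
  (forall x, F (skip2 i x) = G x) ->
  \prod_(x < k.+2) F x = \prod_(0 <= x < i) onat G x * (F i * F (ordS i)) *
     \prod_(i <= x < k) onat G x.
Proof.
move=> im FG; have ik : (i <= k)%N by have := imax_lt im.
have E (x : 'I_k) (y : nat) : y = skip2 i x :> nat -> onat F y = onat G x.
  by move=> ->; rewrite !onat_ord FG.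
rewrite prod_onat (@big_cat_nat _ _ _ i)//=; last by rewrite ltnW// ltnW.
rewrite -mulrA; congr (_ * _).
  apply: eq_big_nat => x /andP[_ xi]; have xk : (x < k)%N by lia.
  by apply: (E (Ordinal xk)); rewrite val_skip2//= xi.
rewrite big_ltn ?ltn_ord// big_ltn ?ltnS// mulrA !big_add1/=; congr (_ * _ * _).
- by rewrite onat_ord.
- by rewrite -(val_ordS im) onat_ord.
apply: eq_big_nat => x /andP[ix xk].
by apply: (E (Ordinal xk)); rewrite val_skip2//= ltnNge ix.
Qed.

Lemma prod_cut k (i : 'I_k.+2) (G : 'I_k -> A) : i != ord_max ->
  \prod_(x < k) G x = \prod_(0 <= x < i) onat G x * \prod_(i <= x < k) onat G x.
Proof.
move=> im; have ik : (i <= k)%N by have := imax_lt im.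
by rewrite prod_onat (@big_cat_nat _ _ _ i).
Qed.

Hypothesis n0 : (0 < n)%N.

(** Sum the relation of p over equal values at the points i and i + 1.  Their
    colors differ, so the two neighboring factors sum to a Kronecker symbol,
    and both sides become the relation of the contraction multiplied by
    [loops], a positive integer. *)
Lemma part_rel_contract_lin k (i : 'I_k.+2) (p : cpart k.+2) : i != ord_max ->
  color p i != color p (ordS i) -> part_rel u p -> part_rel u (pcontract i p).
Proof.
move=> im ci /part_relE hp; apply/part_relE => b.
apply: (@mulrn_inj_alg _ _ (loops i n p)); first exact: loops_gt0.
pose G (g : {ffun 'I_k.+2 -> 'I_n}) x :=
  colored u (color p (skip2 i x)) (b x) (g (skip2 i x)).
pose s := color p i.
have cS : color p (ordS i) = ~~ s by move: ci; rewrite /s; do 2!case: (color p _).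
transitivity (\sum_(c | delta p (insert2 i b c)) (1 : A)); last first.
  by rewrite sumr_const card_insert2// mulnC mulrnA.
transitivity (\sum_c rho u p (insert2 i b c)); last first.
  by rewrite [RHS]big_mkcond; apply: eq_bigr => c _; rewrite hp; case: (delta p _).
transitivity (\sum_(g | delta p g && (g i == g (ordS i))) \prod_(x < k) G g x).
  rewrite (sum_insert2 im); rewrite /rho -sumrMnl [LHS]big_mkcond; apply: eq_bigr => a _.
  under [RHS]eq_bigr => c _.
    under eq_bigr => x _ do rewrite /G (insert2_skip im).
    over.
  rewrite sumr_const card_insert2//; case: (delta _ a); rewrite ?muln0// muln1.
  by congr (_ *+ _); apply: eq_bigr => x _; rewrite color_contract.
rewrite exchange_big/= [LHS]big_mkcondr; apply: eq_bigr => g dg.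
under [RHS]eq_bigr => c _.
  rewrite (@prod_skip2 _ i _ (G g))//; last by move=> x; rewrite /G (insert2_skip im).
  rewrite (insert2_i im) (insert2_S im) cS colored_neg.
  over.
rewrite -mulr_suml -mulr_sumr colored_col (prod_cut _ im).
by case: eqP => _; rewrite ?mulr1// mulr0 mul0r.
Qed.

Lemma block_rotate k (p : cpart k) x y :
  (block (protate p) x == block (protate p) y) =
  (block p (ord_pred x) == block p (ord_pred y)).
Proof. exact: block_fibre. Qed.

(** Contracting the last point with the first is contracting the first two points
    of the rotation. *)
Lemma part_rel_contract k (i : 'I_k.+2) (p : cpart k.+2) :
  color p i != color p (ordS i) -> part_rel u p -> part_rel u (pcontract i p).
Proof.
have [->|im] := eqVneq i ord_max; last exact: part_rel_contract_lin.
have oS : ordS (ord_max : 'I_k.+2) = ord0 by apply: val_inj; rewrite /= modnn.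
have p0 : ord_pred (ord0 : 'I_k.+2) = ord_max by rewrite -oS ordSK.
have pS : ord_pred (ordS (ord0 : 'I_k.+2)) = ord0 by rewrite ordSK.
have z : (ord0 : 'I_k.+2) != ord_max by [].
have sk (x : 'I_k) : ord_pred (skip2 ord0 x) = skip2 (ord_max : 'I_k.+2) x.
  apply: (can_inj (@ordSK k.+2)); rewrite ord_predK; apply: ord_inj.
  have hx := ltn_ord x.
  by rewrite val_skip2// /skip2 eqxx/= inordK ?modn_small//; lia.
rewrite oS => cp hp.
have : part_rel u (pcontract ord0 (protate p)).
  apply: part_rel_contract_lin => //; last exact: part_rel_rotate.
  by rewrite !color_rotate p0 pS.
apply: part_rel_ext => [x|g].
  by rewrite !color_contract color_rotate sk.
suff E x y :
    (block (pcontract ord0 (protate p)) x == block (pcontract ord0 (protate p)) y) =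
    (block (pcontract ord_max p) x == block (pcontract ord_max p) y).
  apply/deltaP/deltaP => h x y /eqP; first by rewrite -E => /eqP/h.
  by rewrite E => /eqP/h.
rewrite !block_fibre !sk pS oS.
by do 2!case: ifP => _; rewrite block_rotate ?sk ?p0 ?pS.
Qed.

Lemma part_rel_sqcap s : part_rel u (sqcap s (~~ s)).
Proof.
apply/part_relE => b; rewrite rho_sqcap delta_sqcap -(colored_row s).
by apply: eq_bigr => c _; rewrite colored_neg.
Qed.

(** The easy direction of Tannaka-Krein duality: the vectors fixed by the tensor
    powers of u and its conjugate are stable under all the operations. *)
Lemma part_rel_category : is_category [set q : cpartition | part_rel u (tagged q)].
Proof.
split=> /=.
- exact: (part_rel_sqcap true).
- exact: (part_rel_sqcap false).
- by move=> k l p q; exact: part_rel_tens.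
- by move=> k i p; exact: part_rel_contract.
- by move=> k p; exact: part_rel_reflect.
- by move=> k p; exact: part_rel_rotate.
Qed.
End Closure.

(** * Color sums and orthogonal matrices *)

Definition nwhite k (p : cpart k) : nat := \sum_(x < k) color p x.
Definition nblack k (p : cpart k) : nat := \sum_(x < k) ~~ color p x.

Lemma color_sumE k (p : cpart k) : color_sum p = (nwhite p)%:Z - (nblack p)%:Z.
Proof.
rewrite /color_sum /nwhite /nblack -!natz !natr_sum -sumrB; apply: eq_bigr => x _.
by case: (color p x).
Qed.

Lemma nwhite_nblack k (p : cpart k) : (nwhite p + nblack p)%N = k.
Proof.
rewrite /nwhite /nblack -big_split/= -[RHS]card_ord -sum1_card.
by apply: eq_bigr => x _; case: (color p x).
Qed.

Lemma nwhite_tens k l (p : cpart k) (q : cpart l) :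
  nwhite (ptens p q) = (nwhite p + nwhite q)%N.
Proof.
rewrite /nwhite big_split_ord/=; congr (_ + _)%N; apply: eq_bigr => x _.
  by rewrite color_tensl.
by rewrite color_tensr.
Qed.

Lemma nblack_tens k l (p : cpart k) (q : cpart l) :
  nblack (ptens p q) = (nblack p + nblack q)%N.
Proof.
rewrite /nblack big_split_ord/=; congr (_ + _)%N; apply: eq_bigr => x _.
  by rewrite color_tensl.
by rewrite color_tensr.
Qed.

Lemma nwhite_reflect k (p : cpart k) : nwhite (preflect p) = nblack p.
Proof.
rewrite /nwhite /nblack (reindex_inj rev_ord_inj)/=; apply: eq_bigr => x _.
by rewrite color_reflect rev_ordK.
Qed.

Lemma nblack_reflect k (p : cpart k) : nblack (preflect p) = nwhite p.
Proof.
rewrite /nwhite /nblack (reindex_inj rev_ord_inj)/=; apply: eq_bigr => x _.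
by rewrite color_reflect rev_ordK negbK.
Qed.

Definition recolor k (p : cpart k) (s : 'I_k -> bool) : cpart k :=
  CPart (blocksP p) (finfun s).

(** The reference partition with an invariant vector for every orthogonal matrix:
    white points paired consecutively. *)
Fixpoint pairing (m : nat) : cpart m.*2 :=
  if m is m'.+1 then ptens (sqcap true true) (pairing m') : cpart m'.+1.*2
  else fibre_part (fun=> tt) (fun=> true).

Lemma color_pairing m x : color (pairing m) x.
Proof.
elim: m x => [[]//|m IHm] x.
rewrite -[pairing m.+1]/(ptens (sqcap true true) (pairing m)).
move: x; change (forall x : 'I_(2 + m.*2), color (ptens (sqcap true true) (pairing m)) x).
move=> x; rewrite -(splitK x); case: (fintype.split x) => y.
  by rewrite (color_tensl _ _ y) color_sqcap; case: ifP.
by rewrite (color_tensr _ _ y).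
Qed.

Section Orthogonal.
Variables (R : realType) (A : cstarType R) (n : nat).
Implicit Types (u : 'M[A]_n) (z : A).

Definition real_mx u := forall a b, star (u a b) = u a b.

Lemma Oplus_Uplus u : Oplus_rel u -> Uplus_rel u.
Proof.
move=> [su h1 h2]; have aE : adjoint_mx u = u^T by apply/matrixP => a b; rewrite !mxE su.
have aE' : adjoint_mx u^T = u by apply/matrixP => a b; rewrite !mxE su.
by split; split; rewrite ?aE ?aE'.
Qed.

Lemma Oplus_tr u : Oplus_rel u -> Oplus_rel u^T.
Proof. by move=> [su h1 h2]; split; rewrite ?trmxK// => a b; rewrite mxE su. Qed.

Lemma colored_real u s a b : real_mx u -> colored u s a b = u a b.
Proof. by move=> su; case: s; rewrite /colored//= su. Qed.

Lemma rho_real u k (p : cpart k) b : real_mx u ->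
  rho u p b = \sum_(g : {ffun 'I_k -> 'I_n} | delta p g) \prod_(x < k) u (b x) (g x).
Proof.
move=> su; apply: eq_bigr => g _; apply: eq_bigr => x _; exact: colored_real.
Qed.

Lemma rho_recolor u k (p : cpart k) s b : real_mx u -> rho u (recolor p s) b = rho u p b.
Proof. by move=> su; rewrite !rho_real. Qed.

Lemma part_rel_recolor u k (p : cpart k) s : real_mx u ->
  part_rel u (recolor p s) <-> part_rel u p.
Proof.
by move=> su; split=> /part_relE h; apply/part_relE => b;
  have := h b; rewrite rho_recolor.
Qed.

Lemma part_rel_sqcap_real u s t : Oplus_rel u -> part_rel u (sqcap s t).
Proof.
move=> hu; have [su _ _] := hu; apply/part_relE => b; rewrite rho_sqcap delta_sqcap.
rewrite -(colored_row (Oplus_Uplus hu) true); apply: eq_bigr => c _.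
by rewrite !colored_real// su.
Qed.

Lemma part_rel_pairing u m : Oplus_rel u -> part_rel u (pairing m).
Proof.
move=> hu; elim: m => [|m IHm].
  apply/part_relE => b; rewrite /rho (big_pred1 b) => [|g].
    by rewrite big_ord0 (_ : delta _ _)//; apply/deltaP => -[].
  have -> : g = b by apply/ffunP => -[].
  by rewrite /= eqxx; apply/deltaP => -[].
apply: (@part_rel_tens _ _ _ _ 2 _ (sqcap true true) (pairing m)) => //.
exact: part_rel_sqcap_real.
Qed.

Lemma starX z m : star (z ^+ m) = star z ^+ m.
Proof.
by elim: m => [|m IHm]; rewrite ?expr0 ?star1// exprS starM IHm exprSr.
Qed.

Lemma expr_inverse (x y : A) m : x * y = 1 -> y * x = 1 -> x ^+ m * y ^+ m = 1.
Proof. by move=> xy yx; rewrite -exprMn_comm ?xy ?expr1n// /GRing.comm xy yx. Qed.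

(** z^c(p), where powers of star(z) stand for negative powers. *)
Definition zpow z k (p : cpart k) : A := z ^+ nwhite p * star z ^+ nblack p.

Lemma prod_comm k (F G : 'I_k -> A) : (forall x y, G x * F y = F y * G x) ->
  \prod_(x < k) (F x * G x) = \prod_(x < k) F x * \prod_(x < k) G x.
Proof.
elim: k F G => [|k IHk] F G FG; first by rewrite !big_ord0 mulr1.
rewrite !big_ord_recr/= IHk//; set a := \prod_(i < k) F _.
rewrite -!mulrA; congr (_ * _); rewrite !mulrA; congr (_ * _).
elim/big_rec: _ => [|x b _ h]; first by rewrite mulr1 mul1r.
by rewrite -mulrA h !mulrA FG.
Qed.

Section Scaled.
Variables (u w : 'M[A]_n) (z : A).
Hypotheses (zz' : z * star z = 1) (z'z : star z * z = 1).
Hypotheses (su : real_mx u) (uz : forall a b, u a b * z = z * u a b).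
Hypothesis (wE : forall a b, w a b = z * u a b).

Lemma uz' a b : u a b * star z = star z * u a b.
Proof. by apply: (can_inj (@starK _ _)); rewrite !starM starK su uz. Qed.

Lemma zpowE k (p : cpart k) : zpow z p = \prod_(x < k) (if color p x then z else star z).
Proof.
have E : \prod_(x < k) (if color p x then z else star z) =
   \prod_(x < k) (z ^+ color p x * star z ^+ (~~ color p x)).
  by apply: eq_bigr => x _; case: (color p x); rewrite ?mulr1 ?mul1r.
rewrite E prod_comm /zpow.
  by rewrite /nwhite /nblack !prodrXr.
by move=> x y; case: (color p x); case: (color p y); rewrite ?mulr1 ?mul1r// zz' z'z.
Qed.

(** The factors z are central, and every white point contributes one z, every
    black point its inverse. *)
Lemma rho_scaled k (p : cpart k) b : rho w p b = zpow z p * rho u p b.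
Proof.
rewrite (rho_real _ _ su) /rho mulr_sumr; apply: eq_bigr => g _.
rewrite zpowE -prod_comm => [|x y]; last by case: ifP => _; rewrite ?uz ?uz'.
apply: eq_bigr => x _; rewrite /colored; case: (color p x) => /=; first by rewrite wE.
by rewrite wE starM su uz'.
Qed.

Lemma zpow_unit k (p : cpart k) : star (zpow z p) * zpow z p = 1.
Proof.
by rewrite /zpow starM !starX starK !mulrA -(mulrA (z ^+ _)) expr_inverse// mulr1
  expr_inverse.
Qed.

Lemma zpow_eq1 k (p : cpart k) m :
  z ^+ m = 1 -> nwhite p = nblack p %[mod m] -> zpow z p = 1.
Proof.
move=> zm h.
rewrite /zpow; have E j : z ^+ j = z ^+ (j %% m).
  by rewrite {1}(divn_eq j m) exprD mulnC exprM zm expr1n mul1r.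
by rewrite E h -E expr_inverse.
Qed.

Lemma part_rel_scaled k (p : cpart k) : zpow z p = 1 -> part_rel w p <-> part_rel u p.
Proof.
by move=> h; split=> /part_relE H; apply/part_relE => b; have := H b;
  rewrite rho_scaled h mul1r.
Qed.

(** Sum the relation of p over the indices constant on pairs.  On one side this is
    the number N of indices constant on the pairs and on the blocks of p, times
    z^-c(p).  On the other side the pairing is invariant under the transpose of
    u, and the sum is N. *)
Lemma zpow_even k (p : cpart k.*2) :
  (0 < n)%N -> Oplus_rel u -> part_rel w p -> zpow z p = 1.
Proof.
move=> n0 ou /part_relE hw; have hp b : rho u p b = (delta p b)%:R * star (zpow z p).
  by rewrite -commr_nat -hw rho_scaled mulrA zpow_unit mul1r.
suff h : star (zpow z p) = 1 by rewrite -[LHS]starK h star1.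
pose N := #|[pred g : {ffun 'I_k.*2 -> 'I_n} | delta p g && delta (pairing k) g]|.
have N0 : (0 < N)%N.
  apply/card_gt0P; exists [ffun=> Ordinal n0].
  by rewrite inE !delta_const.
apply: (mulrn_inj_alg N0).
transitivity (\sum_(b | delta (pairing k) b) rho u p b).
  rewrite -sumr_const big_mkcond [RHS]big_mkcond; apply: eq_bigr => b _.
  by rewrite hp inE; case: (delta p b); case: (delta _ b); rewrite /= ?mul1r ?mul0r.
have /part_relE hq := part_rel_pairing (m := k) (Oplus_tr ou).
transitivity (\sum_(g | delta p g) rho u^T (pairing k) g); last first.
  rewrite -sumr_const big_mkcond [RHS]big_mkcond; apply: eq_bigr => b _.
  by rewrite hq inE; case: (delta p b); case: (delta _ b).
have su' : real_mx u^T by move=> a b; rewrite mxE su.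
under eq_bigr do rewrite rho_real//.
rewrite exchange_big/=; apply: eq_bigr => g _; rewrite rho_real//.
by apply: eq_bigr => b _; apply: eq_bigr => x _; rewrite mxE.
Qed.

End Scaled.
End Orthogonal.

(** * Splitting off a central unitary *)

Section HomMatrix.
Variables (R : realType) (A B : cstarType R) (f : starHom A B) (n : nat).
Implicit Types u : 'M[A]_n.

Definition hom_mx u : 'M[B]_n := \matrix_(a, b) f (u a b).

Lemma hom_sum I (r : seq I) (P : pred I) (F : I -> A) :
  f (\sum_(i <- r | P i) F i) = \sum_(i <- r | P i) f (F i).
Proof. exact: rmorph_sum. Qed.
Lemma hom_prod I (r : seq I) (P : pred I) (F : I -> A) :
  f (\prod_(i <- r | P i) F i) = \prod_(i <- r | P i) f (F i).
Proof. exact: rmorph_prod. Qed.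
Lemma hom_nat m : f m%:R = m%:R.
Proof. exact: rmorph_nat. Qed.

Lemma colored_hom_mx u s a b : colored (hom_mx u) s a b = f (colored u s a b).
Proof. by case: s; rewrite /colored/= !mxE// hom_star. Qed.

Lemma rho_hom_mx u k (p : cpart k) b : rho (hom_mx u) p b = f (rho u p b).
Proof.
rewrite hom_sum; apply: eq_bigr => g _; rewrite hom_prod; apply: eq_bigr => x _.
exact: colored_hom_mx.
Qed.

Lemma part_rel_hom_mx u k (p : cpart k) : part_rel u p -> part_rel (hom_mx u) p.
Proof. by move=> /part_relE h; apply/part_relE => b; rewrite rho_hom_mx h hom_nat. Qed.

Lemma part_rel_hom_mx_inj u k (p : cpart k) :
  injective f -> part_rel (hom_mx u) p -> part_rel u p.
Proof.
move=> fI /part_relE h; apply/part_relE => b; apply: fI.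
by rewrite -rho_hom_mx h hom_nat.
Qed.

Lemma hom_mx_mul u v : hom_mx (u *m v) = hom_mx u *m hom_mx v.
Proof.
apply/matrixP => a b; rewrite !mxE hom_sum; apply: eq_bigr => c _.
by rewrite !mxE homM.
Qed.
Lemma hom_mx1 : hom_mx 1%:M = 1%:M.
Proof. by apply/matrixP => a b; rewrite !mxE hom_nat. Qed.
Lemma hom_mx_adj u : hom_mx (adjoint_mx u) = adjoint_mx (hom_mx u).
Proof. by apply/matrixP => a b; rewrite !mxE hom_star. Qed.
Lemma hom_mx_tr u : hom_mx u^T = (hom_mx u)^T.
Proof. by apply/matrixP => a b; rewrite !mxE. Qed.

Lemma unitary_hom_mx u : unitary_mx u -> unitary_mx (hom_mx u).
Proof. by move=> [h1 h2]; split; rewrite -hom_mx_adj -hom_mx_mul ?h1 ?h2 hom_mx1. Qed.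

Lemma hom_mx_inj : injective f -> injective hom_mx.
Proof.
move=> fI u v /matrixP h; apply/matrixP => a b; apply: fI.
by have := h a b; rewrite !mxE.
Qed.

Lemma Uplus_hom_mx_inj u : injective f -> Uplus_rel (hom_mx u) -> Uplus_rel u.
Proof.
move=> /hom_mx_inj fI [[h1 h2] [h3 h4]]; rewrite -hom_mx_tr in h3 h4.
by split; split; apply: fI; rewrite hom_mx_mul hom_mx_adj hom_mx1.
Qed.

End HomMatrix.

Section Splitting.
Variables (R : realType) (n : nat).

(** The matrix w comes from an orthogonal matrix u and a unitary z commuting with
    it, as the fundamental representation of a glued product does. *)
Record splits (A : cstarType R) (w : 'M[A]_n) (z : A) (u : 'M[A]_n) : Prop := Splits {
  split_zz' : z * star z = 1;
  split_z'z : star z * z = 1;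
  split_orth : Oplus_rel u;
  split_comm : forall a b, u a b * z = z * u a b;
  split_eq : forall a b, w a b = z * u a b }.

Lemma splits_Uplus (A : cstarType R) (w : 'M[A]_n) z u : splits w z u -> Uplus_rel w.
Proof.
case=> zz' z'z ou uz wE; have [su _ _] := ou; have hu := Oplus_Uplus ou.
have uz' := uz' su uz.
have E1 a b c d : w a b * star (w c d) = u a b * star (u c d).
  by rewrite !wE starM su -uz uz' mulrA -(mulrA (u a b)) zz' mulr1.
have E2 a b c d : star (w a b) * w c d = star (u a b) * u c d.
  by rewrite !wE starM -mulrA (mulrA (star z)) z'z mul1r.
case: hu => [[/matrixP h1 /matrixP h2] [/matrixP h3 /matrixP h4]].
split; split; apply/matrixP => a b.
- by rewrite -h1 !mxE; apply: eq_bigr => c _; rewrite !mxE E1.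
- by rewrite -h2 !mxE; apply: eq_bigr => c _; rewrite !mxE E2.
- by rewrite -h3 !mxE; apply: eq_bigr => c _; rewrite !mxE E1.
- by rewrite -h4 !mxE; apply: eq_bigr => c _; rewrite !mxE E2.
Qed.

(** A central symmetry e can be moved between the two factors. *)
Lemma splits_twist (A : cstarType R) (w : 'M[A]_n) z u e : splits w z u ->
  star e = e -> e * e = 1 -> (forall a b, u a b * e = e * u a b) -> z * e = e * z ->
  splits w (z * e) (\matrix_(a, b) (e * u a b)).
Proof.
case=> zz' z'z [su h1 h2] uz wE se ee ue ze.
have E a b c d : e * u a b * (e * u c d) = u a b * u c d.
  by rewrite -ue -mulrA (mulrA e) ee mul1r.
split.
- by rewrite starM se mulrA -(mulrA z) ee mulr1.
- by rewrite starM se -mulrA (mulrA _ z) z'z mul1r.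
- split=> [a b||].
  + by rewrite mxE starM se su ue.
  + rewrite -h1; apply/matrixP => a b; rewrite !mxE; apply: eq_bigr => c _.
    by rewrite !mxE E.
  + rewrite -h2; apply/matrixP => a b; rewrite !mxE; apply: eq_bigr => c _.
    by rewrite !mxE E.
- move=> a b; rewrite mxE -!mulrA (mulrA (u a b)) uz -(mulrA z) ue.
  by rewrite !mulrA ze.
- by move=> a b; rewrite mxE mulrA -(mulrA z) ee mulr1.
Qed.

Variable (n0 : (0 < n)%N).

(** The relation says X_ab star(X_dc) = delta_ab delta_cd for X = w w^T.  Since X is
    unitary, X_ab = sum_c (X_ab star(X_cb)) X_cb vanishes for a <> b; the
    diagonal entries are unitaries with X_aa star(X_bb) = 1, hence all equal
    to some t.  Then w^T = star(w) w w^T = star(w) t. *)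
Lemma colorized_unitary (B : cstarType R) (w : 'M[B]_n) : Uplus_rel w ->
  part_rel w (ptens (sqcap white white) (sqcap black black)) ->
  exists t : B, [/\ t * star t = 1, star t * t = 1,
    forall a b, w a b = t * star (w a b) & forall a b, w a b * t = t * w a b].
Proof.
move=> hw /part_relE gc.
pose X a b := \sum_c w a c * w b c.
have YX a b : star (X a b) = \sum_c star (w b c) * star (w a c).
  by rewrite star_sum; apply: eq_bigr => c _; rewrite starM.
have XY a b c d : X a b * star (X d c) = ((a == b) && (c == d))%:R.
  (* indices (a, b) on the white pair and (c, d) on the black pair *)
  have := gc [ffun x : 'I_(2 + 2) => nth a [:: a; b; c; d] x].
  by rewrite rho_tens !rho_sqcap delta_tens !delta_sqcap !ffunE /= YX.
have XX : forall a c, \sum_b star (X b a) * X b c = (a == c)%:R.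
  move=> a c; have [[_ h2] [_ h4]] := hw.
  have : adjoint_mx (w *m w^T) *m (w *m w^T) = 1%:M.
    by rewrite adjoint_mulmx mulmxA -(mulmxA _ _ w) h2 mulmx1 h4.
  move/matrixP => /(_ a c); rewrite mxE [in X in _ = X]mxE => <-.
  apply: eq_bigr => b _; rewrite !mxE; congr (star _ * _).
    by apply: eq_bigr => d _; rewrite mxE.
  by apply: eq_bigr => d _; rewrite mxE.
have Xoff a b : a != b -> X a b = 0.
  move=> ab; have <- : X a b * \sum_c star (X c b) * X c b = X a b.
    by rewrite XX eqxx mulr1.
  rewrite mulr_sumr big1 // => c _; rewrite mulrA XY (negbTE ab).
  by rewrite mul0r.
have XX1 a b : X a a * star (X b b) = 1 by rewrite XY !eqxx.
have XX2 a : star (X a a) * X a a = 1.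
  have := XX a a; rewrite eqxx (bigD1 a)//= big1 ?addr0// => c ca.
  by rewrite (Xoff c a)// mulr0.
have Xdiag a b : X a a = X b b by rewrite -[LHS]mulr1 -(XX2 b) mulrA XX1 mul1r.
pose i0 := Ordinal n0; pose t := X i0 i0.
have XE a b : X a b = if a == b then t else 0.
  by case: eqVneq => [<-|/Xoff//]; exact: Xdiag.
have e1 a b : w b a = star (w b a) * t.
  have [[_ /matrixP h2] _] := hw.
  have : \sum_c star (w c a) * X c b = w b a.
    transitivity (\sum_d (\sum_c star (w c a) * w c d) * w b d).
      under [RHS]eq_bigr do rewrite mulr_suml.
      rewrite exchange_big/=; apply: eq_bigr => c _; rewrite mulr_sumr.
      by apply: eq_bigr => d _; rewrite mulrA.
    have H2 d : \sum_c star (w c a) * w c d = (a == d)%:R.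
      by have := h2 a d; rewrite !mxE => <-; apply: eq_bigr => c _; rewrite mxE.
    under eq_bigr do rewrite H2.
    rewrite (bigD1 a)//= eqxx mul1r big1 ?addr0// => d da.
    by rewrite eq_sym (negbTE da) mul0r.
  rewrite (bigD1 b)//= XE eqxx big1 ?addr0// => c cb.
  by rewrite XE (negbTE cb) mulr0.
have tt : t * star t = 1 by exact: XX1.
have tt' : star t * t = 1 by exact: XX2.
have e2 a b : w a b = t * star (w a b).
  by rewrite {2}(e1 b a) starM starK mulrA tt mul1r.
exists t; split=> // a b.
by rewrite [in LHS](e2 a b) -mulrA -e1.
Qed.

(** Divide w by a square root of the unitary t of [colorized_unitary]; both
    w_ab = t star(w_ab) and z^2 = t are needed for the quotient to be
    self-adjoint. *)
Lemma root_extension (B : cstarType R) (w : 'M[B]_n) : Uplus_rel w ->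
  part_rel w (ptens (sqcap white white) (sqcap black black)) ->
  exists (D : cstarType R) (e : starHom B D) (E : D -> B) (z : D) (u : 'M[D]_n),
    [/\ cancel e E, forall x y, rnorm (E x - E y) <= rnorm (x - y)
      & splits (hom_mx e w) z u].
Proof.
move=> hw gc; have [t [tt' t't wt tw]] := colorized_unitary hw gc.
have [D [e [E [z [eK Ec [zz' z'z] zz zc]]]]] := sqrt_extension tt' t't.
have ezw a b : e (w a b) * z = z * e (w a b) by apply: zc.
have sw a b : star (w a b) = star t * w a b.
  by rewrite {2}(wt a b) mulrA t't mul1r.
have ezs a b : e (star (w a b)) * z = z * e (star (w a b)).
  apply: zc; rewrite sw -mulrA tw mulrA t't mul1r.
  by rewrite mulrA tt' mul1r.
have ew a b : e (w a b) = z * z * e (star (w a b)) by rewrite {1}wt homM zz.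
pose u : 'M[D]_n := \matrix_(a, b) (star z * e (w a b)).
have uE a b : u a b = z * e (star (w a b)).
  by rewrite mxE ew !mulrA z'z mul1r.
have ezw' a b : e (w a b) * star z = star z * e (w a b).
  have := congr1 (@star _ _) (ezs a b).
  by rewrite !starM -!hom_star starK => ->.
have su : real_mx u by move=> a b; rewrite {1}uE starM -hom_star starK ezw' mxE.
have uu a b c d : u a b * u c d = star z * e (w a b * star (w c d)) * z.
  by rewrite mxE (uE c d) -ezs homM !mulrA.
exists D, e, E, z, u; split=> //; split=> //.
- split=> //; apply/matrixP => a b; rewrite !mxE.
    have := colored_row hw true a b; rewrite /colored/= => h.
    under eq_bigr => c _ do rewrite [u^T _ _]mxE uu.
    rewrite -mulr_suml -mulr_sumr -hom_sum h hom_nat.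
    by rewrite commr_nat -mulrA z'z mulr1.
  have := colored_col hw true a b; rewrite /colored/= => h.
  under eq_bigr => c _ do rewrite [u^T _ _]mxE uu.
  rewrite -mulr_suml -mulr_sumr -hom_sum h hom_nat.
  by rewrite commr_nat -mulrA z'z mulr1.
- by move=> a b; rewrite mxE -mulrA ezw !mulrA z'z zz'.
- by move=> a b; rewrite !mxE mulrA zz' mul1r.
Qed.

End Splitting.

(** * Color sums in a category and roots of order k *)

Section Kcat.
Variable C : set cpartition.
Hypothesis hC : is_category C.

(** Color sums of the members of C, stated without subtraction. *)
Definition has_sum (m : nat) :=
  exists k (p : cpart k), C (pack p) /\ nwhite p = (nblack p + m)%N.

Lemma has_color_sumP m : reflect ((0 < m)%N /\ has_sum m) (has_color_sum C m).
Proof.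
apply: (iffP andP) => -[m0].
  move=> /asboolP[k [p [Cp ps]]]; split=> //; exists k, p; split=> //.
  by move: ps; rewrite color_sumE; lia.
move=> [k [p [Cp ps]]]; split=> //; apply/asboolP; exists k, p; split=> //.
by rewrite color_sumE ps; lia.
Qed.

Lemma has_sum_kcat : (0 < kcat C)%N -> has_sum (kcat C).
Proof.
rewrite /kcat; case: pselect => // ex _.
by case: ex_minnP => m /has_color_sumP[].
Qed.

(** The color sums of C form a subgroup of the integers: sums come from tensor
    products and opposites from reflections. *)
Lemma kcat_dvd m : has_sum m -> (kcat C %| m)%N.
Proof.
elim/ltn_ind: m => m IHm hm; have [->|m0] := posnP m; first by rewrite dvdn0.
have hs : has_color_sum C m by apply/has_color_sumP.
have : has_color_sum C (kcat C) /\ (kcat C <= m)%N.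
  rewrite /kcat; case: pselect => [ex|[]]; last by exists m.
  by case: ex_minnP => j hj jm; split=> //; apply: jm.
move=> [/has_color_sumP[k0 [l [q [Cq qs]]]] km].
rewrite -(subnK km) dvdn_add//; apply: IHm; first by lia.
have [k [p [Cp ps]]] := hm.
exists (k + l)%N, (ptens p (preflect q)); split.
  by apply: (cat_tens hC) => //; apply: (cat_reflect hC).
by rewrite nwhite_tens nblack_tens nwhite_reflect nblack_reflect; lia.
Qed.

Lemma kcat_mod k (p : cpart k) : C (pack p) -> nwhite p = nblack p %[mod kcat C].
Proof.
move=> Cp; case: (leqP (nblack p) (nwhite p)) => h.
  have /dvdnP[j e] : (kcat C %| nwhite p - nblack p)%N.
    by apply: kcat_dvd; exists k, p; split=> //; rewrite subnKC.
  by rewrite -(subnKC h) e addnC modnMDl.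
have /dvdnP[j e] : (kcat C %| nblack p - nwhite p)%N.
  apply: kcat_dvd; exists k, (preflect p); split; first exact: (cat_reflect hC).
  by rewrite nwhite_reflect nblack_reflect subnKC// ltnW.
by rewrite -(subnKC (ltnW h)) e addnC modnMDl.
Qed.

End Kcat.

Section ChooseRoot.
Variables (R : realType) (n : nat).

(** z^(k+1) is z times the symmetry z^k, and its k-th power is an even power of
    z^k. *)
Lemma odd_root (A : cstarType R) (w : 'M[A]_n) z u k :
  splits w z u -> odd k -> z ^+ k * z ^+ k = 1 ->
  exists z' u', splits w z' u' /\ z' ^+ k = 1.
Proof.
move=> hs ok zk2; have [zz' z'z ou uz wE] := hs.
have sk : star (z ^+ k) = z ^+ k.
  by rewrite starX -[LHS]mulr1 -zk2 mulrA expr_inverse// mul1r.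
exists (z * z ^+ k), (\matrix_(a, b) (z ^+ k * u a b)); split.
  apply: splits_twist => //.
    by move=> a b; apply: commrX.
  by rewrite -exprS exprSr.
have -> : (z * z ^+ k) ^+ k = (z ^+ k * z ^+ k) ^+ (k./2).+1.
  rewrite -exprS -exprD -!exprM; congr (_ ^+ _).
  by have := odd_double_half k; rewrite ok -muln2; nia.
by rewrite zk2 expr1n.
Qed.

Lemma zpow_sum (A : cstarType R) (z : A) m (q : cpart m) j :
  z * star z = 1 -> star z * z = 1 -> nwhite q = (nblack q + j)%N -> zpow z q = z ^+ j.
Proof.
by move=> zz' z'z h; rewrite /zpow h addnC exprD -mulrA expr_inverse// mulr1.
Qed.

Hypothesis n0 : (0 < n)%N.

Lemma zpow_even_size (A : cstarType R) (w : 'M[A]_n) z u k (p : cpart k) :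
  splits w z u -> ~~ odd k -> part_rel w p -> zpow z p = 1.
Proof.
case=> zz' z'z ou uz wE ek; have [su _ _] := ou.
have e : k = k./2.*2 by rewrite even_halfK.
by move: p; rewrite e => p; apply: (zpow_even zz' z'z su uz wE).
Qed.

(** For odd k two copies of p have an even number of points. *)
Lemma choose_root (A : cstarType R) (w : 'M[A]_n) z u k l (p : cpart l) :
  splits w z u -> part_rel w p -> nwhite p = (nblack p + k)%N ->
  exists z' u', splits w z' u' /\ z' ^+ k = 1.
Proof.
move=> hs hp ps; have [zz' z'z _ _ _] := hs.
have [ok|ek] := boolP (odd k); last first.
  exists z, u; split=> //; rewrite -(zpow_sum zz' z'z ps); apply: zpow_even_size hs _ hp.
  by rewrite -(nwhite_nblack p) ps; move: ek; rewrite !oddD; case: (odd k); case: odd.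
apply: (odd_root hs ok).
rewrite -exprD -(@zpow_sum _ _ _ (ptens p p))//; last first.
  by rewrite nwhite_tens nblack_tens; lia.
apply: zpow_even_size hs _ _; first by rewrite addnn odd_double.
exact: part_rel_tens.
Qed.
End ChooseRoot.

(** * Easy quantum groups *)

Section Easy.
Variables (R : realType) (n : nat).
Implicit Types A B : cstarType R.

(** Comultiplication preserves the relations: as the two copies of the algebra
    commute, the vector of p is transported by the product of the matrices by
    transporting it twice. *)
Lemma easy_hom_mulmx (C : set cpartition) A T (i j : starHom A T) (u : 'M[A]_n) :
  commuting i j -> easy_rel C u -> easy_rel C (hom_mx i u *m hom_mx j u).
Proof.
move=> ij [hu hC]; set W := _ *m _.
have WE a b : W a b = \sum_k i (u a k) * j (u k b).
  by rewrite mxE; apply: eq_bigr => k _; rewrite !mxE.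
have cW s a b : colored W s a b = \sum_k i (colored u s a k) * j (colored u s k b).
  case: s; rewrite /colored/= WE// star_sum; apply: eq_bigr => k _.
  by rewrite starM -!hom_star ij.
have trW : W^T = hom_mx j u^T *m hom_mx i u^T.
  by apply/matrixP => a b; rewrite !mxE; apply: eq_bigr => k _; rewrite !mxE ij.
have un X Y : unitary_mx X -> unitary_mx Y -> unitary_mx (X *m Y) :> Prop.
  move=> [h1 h2] [h3 h4]; split; rewrite adjoint_mulmx.
    by rewrite mulmxA -(mulmxA X) h3 mulmx1 h1.
  by rewrite mulmxA -(mulmxA _ _ X) h2 mulmx1 h4.
split.
  have [h1 h2] := hu; split; rewrite ?trW; apply: un; exact: unitary_hom_mx.
move=> k p Cp; have /part_relE hp := hC _ _ Cp; apply/part_relE => b.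
rewrite /rho.
transitivity (\sum_(g | delta p g) \sum_(h : {ffun 'I_k -> 'I_n})
  i (\prod_(x < k) colored u (color p x) (b x) (h x)) *
  j (\prod_(x < k) colored u (color p x) (h x) (g x))).
  apply: eq_bigr => g _; under eq_bigr do rewrite cW.
  rewrite bigA_distr_bigA/=; apply: eq_bigr => h _.
  by rewrite prod_comm ?hom_prod// => x y; rewrite ij.
rewrite exchange_big/=.
transitivity (\sum_(h : {ffun 'I_k -> 'I_n})
  i (\prod_(x < k) colored u (color p x) (b x) (h x)) * (delta p h)%:R).
  by apply: eq_bigr => h _; rewrite -mulr_sumr -hom_sum -/(rho u p h) hp hom_nat.
rewrite -(hom_nat i) -hp /rho hom_sum [RHS]big_mkcond; apply: eq_bigr => h _.
by case: (delta p h); rewrite ?mulr1 ?mulr0.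
Qed.

Lemma easy_cmqg (C : set cpartition) (G : qgroup R n) : easy_qg C G -> cmqg G.
Proof.
move=> [hr hg hu]; have [[[h1 h2] [h3 h4]] _] := hr; split=> //.
- by exists (adjoint_mx (qfund G)).
- by exists (adjoint_mx (qfund G)^T).
move=> T i j [[ij _ _] _].
have [f hf] := hu T _ (easy_hom_mulmx ij hr).
by exists f => a b; rewrite hf mxE; apply: eq_bigr => k _; rewrite !mxE.
Qed.

Lemma easy_unitary (C : set cpartition) (G : qgroup R n) : easy_qg C G -> unitary_qg G.
Proof.
move=> [[hr _] _ _] U [_ _ hU]; exists erefl.
by have [f hf] := hU _ _ hr; exists f => a b; rewrite hf !cast_ord_id.
Qed.

(** The relation of the white pair is u u^T = 1, so the transpose of u is its
    inverse, that is, its adjoint. *)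
Lemma Uplus_Oplus A (u : 'M[A]_n) : Uplus_rel u -> part_rel u (sqcap white white) ->
  Oplus_rel u.
Proof.
move=> hu /part_relE h.
have h1 : u *m u^T = 1%:M.
  apply/matrixP => a b; rewrite !mxE.
  have := h [ffun x => if x == ord0 then a else b].
  rewrite rho_sqcap delta_sqcap !ffunE/= => <-; apply: eq_bigr => c _.
  by rewrite mxE.
have [[_ h2] _] := hu.
have e : u^T = adjoint_mx u by rewrite -[LHS]mul1mx -h2 -mulmxA h1 mulmx1.
split=> //; last by rewrite e.
by move=> a b; have /matrixP /(_ b a) := e; rewrite !mxE.
Qed.

Lemma easy_orthogonal (C : set cpartition) (G : qgroup R n) :
  non_colored C -> easy_qg C G -> orthogonal_qg G.
Proof.
move=> nc [[hr hp] _ _] U [_ _ hU]; exists erefl.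
have [f hf] := hU _ _ (Uplus_Oplus hr (hp _ _ nc)).
by exists f => a b; rewrite hf !cast_ord_id.
Qed.

Lemma hom_id A : exists f : starHom A A, forall x, f x = x.
Proof. by apply: (@starHom_intro _ A A id). Qed.

Lemma hom_comp A B D (g : starHom B D) (f : starHom A B) :
  exists h : starHom A D, forall x, h x = g (f x).
Proof.
apply: (@starHom_intro _ A D (fun x => g (f x))).
- by move=> x y; rewrite !homD.
- by rewrite !hom1.
- by move=> x y; rewrite !homM.
- by move=> a x; rewrite !homZ.
- by move=> x; rewrite !hom_star.
Qed.

Lemma universal_eq (rel : forall m (A : cstarType R), 'M[A]_m -> Prop)
    (m : nat) (e : n = m) (G : qgroup R n) (K : qgroup R m) :
  universal (@rel n) G -> universal (@rel m) K -> qg_eq G K.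
Proof.
case: _ / e K => K [rG gG uG] [rK gK uK]; exists erefl.
have [f hf] := uG _ _ rK; have [g hg] := uK _ _ rG; exists f; split; last first.
  by move=> a b; rewrite hf !cast_ord_id.
have [gf gfE] := hom_comp g f; have [fg fgE] := hom_comp f g.
have [iG iGE] := hom_id (qalg G); have [iK iKE] := hom_id (qalg K).
exists g => x.
  rewrite -gfE -[RHS]iGE; apply: (hom_ext gG) => _ [a [b ->]].
  by rewrite gfE iGE hf hg.
rewrite -fgE -[RHS]iKE; apply: (hom_ext gK) => _ [a [b ->]].
by rewrite fgE iKE hg hf.
Qed.

End Easy.

(** * The glued product with the dual of a cyclic group *)

Section Glue.
Variables (R : realType) (n k : nat) (H K : qgroup R n) (Z : qgroup R 1).
Variable relH : forall A : cstarType R, 'M[A]_n -> Prop.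
Hypotheses (uH : universal relH H) (uZ : is_dual_cyclic k Z).
Hypothesis orthH : Oplus_rel (qfund H).
Variables (T : cstarType R) (i : starHom (qalg H) T) (j : starHom (qalg Z) T)
  (iota : starHom (qalg K) T).
Hypotheses (maxT : max_tensor i j) (iota_inj : injective iota).
Hypothesis iota_range : range iota =
  cstar_gen [set x | exists a b, x = i (qfund H a b) * j (qfund Z 0 0)].
Hypothesis iotaE : forall a b, iota (qfund K a b) = i (qfund H a b) * j (qfund Z 0 0).

Lemma glued_gen : cstar_gen (entries (qfund K)) = setT.
Proof.
apply: (cstar_gen_inj iota_inj); rewrite iota_range; congr cstar_gen.
apply/seteqP; split=> [x [a [b ->]]|_ [_ [a [b ->]] <-]].
  by exists (qfund K a b); [exists a, b|rewrite iotaE].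
by exists a, b; rewrite iotaE.
Qed.

Lemma glued_splits :
  splits (hom_mx iota (qfund K)) (j (qfund Z 0 0)) (hom_mx i (qfund H)) /\
  j (qfund Z 0 0) ^+ k = 1.
Proof.
have [[zz' z'z zk] _ _] := uZ; have [[ij _ _] _] := maxT.
have [su h1 h2] := orthH.
split; last first.
  rewrite -[RHS](hom1 j) -zk.
  by elim: k => [|m IHm]; rewrite ?expr0 ?hom1// !exprS homM IHm.
split.
- by rewrite -hom_star -homM zz' hom1.
- by rewrite -hom_star -homM z'z hom1.
- split.
  + by move=> a b; rewrite mxE -hom_star su.
  + by rewrite -hom_mx_tr -hom_mx_mul h1 hom_mx1.
  + by rewrite -hom_mx_tr -hom_mx_mul h2 hom_mx1.
- by move=> a b; rewrite mxE ij.
- by move=> a b; rewrite !mxE iotaE ij.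
Qed.

Lemma glued_Uplus : Uplus_rel (qfund K).
Proof.
have [hs _] := glued_splits.
exact: (Uplus_hom_mx_inj iota_inj (splits_Uplus hs)).
Qed.

Lemma glued_part_rel l (p : cpart l) : part_rel (qfund H) p ->
  nwhite p = nblack p %[mod k] -> part_rel (qfund K) p.
Proof.
move=> hp ps; have [[zz' z'z ou uz wE] zk] := glued_splits; have [su _ _] := ou.
apply: (part_rel_hom_mx_inj iota_inj).
apply/(part_rel_scaled zz' z'z su uz wE); last exact: part_rel_hom_mx.
exact: zpow_eq1 zk ps.
Qed.

(** The range of e is closed because E is a contraction inverse to e on it. *)
Lemma cstar_range (B D : cstarType R) (e : starHom B D) (E : D -> B) :
  cancel e E -> (forall x y, rnorm (E x - E y) <= rnorm (x - y)) ->
  cstar_subalg [set y : D | y = e (E y)].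
Proof.
move=> eK Ec; split=> /=.
- apply/closed_rnormP => y hy; apply/eqP; rewrite -subr_eq0; apply/eqP.
  apply: (@rnorm_small_eq0 _ _ _ 2) => d /hy[x /= xE h].
  have -> : y - e (E y) = (y - x) - e (E y - E x).
    by rewrite homB -xE opprB addrA subrK.
  apply: le_trans (rnormB _ _) _.
  by have := hom_contract e (E y - E x); have := Ec y x; lra.
- by rewrite -{2}(hom1 e) eK hom1.
- by move=> x y -> ->; rewrite -homD eK.
- by move=> a x ->; rewrite -homZ eK.
- by move=> x y -> ->; rewrite -homM eK.
- by move=> x ->; rewrite -hom_star eK.
Qed.

Lemma hom_commute (B D : cstarType R) (f : starHom B D) (X : set B) (d : D) :
  cstar_gen X = setT ->
  (forall x, X x -> f x * d = d * f x /\ f x * star d = star d * f x) ->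
  forall x, f x * d = d * f x /\ f x * star d = star d * f x.
Proof.
move=> gX h x.
apply: (cstar_gen_sub (cstar_preimage f (cstar_commutant d)) (X := X)) => //.
by rewrite gX.
Qed.

(** The universal properties of C(H) and of the group algebra give commuting
    homomorphisms into D, and so one on the maximal tensor product.  Restricted
    to C(K) it maps generators into the copy of B inside D, hence everything. *)
Lemma glued_univ (B D : cstarType R) (w : 'M[B]_n) (e : starHom B D) (E : D -> B)
    (z : D) (u : 'M[D]_n) :
  cancel e E -> (forall x y, rnorm (E x - E y) <= rnorm (x - y)) ->
  splits (hom_mx e w) z u -> z ^+ k = 1 -> relH u ->
  exists f : starHom (qalg K) B, forall a b, f (qfund K a b) = w a b.
Proof.
move=> eK Ec [zz' z'z [su h1 h2] uz wE] zk hu.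
have [_ gH huH] := uH; have [_ gZ huZ] := uZ.
have [f hf] := huH _ _ hu.
have [|g hg] := huZ D (\matrix_(a, b) z); first by split; rewrite mxE.
have uz' := uz' su uz.
have fg : commuting f g.
  move=> x y; apply: (proj1 (hom_commute gH _ x)) => _ [a [b ->]]; rewrite hf.
  have [c1 c2] : g y * u a b = u a b * g y /\ g y * star (u a b) = star (u a b) * g y.
    apply: (hom_commute gZ) => _ [c [c' ->]].
    by rewrite hg mxE su uz.
  split=> //; apply: (can_inj (@starK _ _)).
  by rewrite !starM starK su.
have [_ /(_ D f g fg)[h [hi hj]]] := maxT.
have [q qE] := hom_comp h iota.
have qw a b : q (qfund K a b) = e (w a b).
  by rewrite qE iotaE homM hi hj hf hg mxE uz -wE mxE.
have qe x : q x = e (E (q x)).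
  have S := cstar_preimage q (cstar_range eK Ec).
  have := cstar_gen_sub S (X := entries (qfund K)).
  rewrite glued_gen => /(_ _ x); apply=> //.
  by move=> _ [a [b ->]] /=; rewrite qw eK.
have eI := can_inj eK.
have [||||| r rE] := @starHom_intro _ (qalg K) B (fun x => E (q x)).
- by move=> x y; apply: eI; rewrite -[LHS]qe [RHS]homD /= -!qe homD.
- by apply: eI; rewrite -[LHS]qe !hom1.
- by move=> x y; apply: eI; rewrite -[LHS]qe [RHS]homM /= -!qe homM.
- by move=> a x; apply: eI; rewrite -[LHS]qe [RHS]homZ /= -!qe homZ.
- by move=> x; apply: eI; rewrite -[LHS]qe [RHS]hom_star /= -!qe hom_star.
by exists r => a b; rewrite rE qw eK.
Qed.

End Glue.

(** * Splitting solutions of the relations *)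

Section Colorized.
Variables (R : realType) (n : nat).
Hypothesis n0 : (0 < n)%N.

(** The partitions whose relation holds for u form a category.  It contains C,
    since k divides all color sums of C, and the white pair, since u is
    orthogonal. *)
Lemma colorized_split (C : set cpartition) (B : cstarType R) (w : 'M[B]_n) :
  is_category C -> globally_colorized C -> easy_rel C w ->
  exists (D : cstarType R) (e : starHom B D) (E : D -> B) (z : D) (u : 'M[D]_n),
    [/\ cancel e E, forall x y, rnorm (E x - E y) <= rnorm (x - y),
      splits (hom_mx e w) z u, z ^+ kcat C = 1
      & easy_rel (generated_category (C `|` [set pack (sqcap white white)])) u].
Proof.
move=> hC gC [hw hp].
have [D [e [E [z0 [u0 [eK Ec hs0]]]]]] := root_extension n0 hw (hp _ _ gC).
have [z [u [hs zk]]] : exists z u, splits (hom_mx e w) z u /\ z ^+ kcat C = 1.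
  have [->|k0] := posnP (kcat C); first by exists z0, u0.
  have [l [p [Cp ps]]] := has_sum_kcat k0.
  apply: (choose_root n0 hs0 _ ps); exact/part_rel_hom_mx/hp.
exists D, e, E, z, u; split=> //.
have [zz' z'z ou uz wE] := hs; have [su _ _] := ou; have Uu := Oplus_Uplus ou.
split=> // k p; apply: (smallest_sub (part_rel_category Uu n0)) => -[l q] [Cq|->].
  apply/(part_rel_scaled zz' z'z su uz wE); last exact/part_rel_hom_mx/hp.
  exact/(zpow_eq1 zz' z'z zk)/kcat_mod.
exact: part_rel_sqcap_real.
Qed.

End Colorized.

Section Complexification.
Variables (R : realType) (n : nat).
Hypothesis n0 : (0 < n)%N.

Lemma rho_commute (A : cstarType R) (u : 'M[A]_n) (d : A) l (p : cpart l) b :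
  real_mx u -> (forall a b, u a b * d = d * u a b) -> rho u p b * d = d * rho u p b.
Proof.
move=> su ud; rewrite rho_real// mulr_suml mulr_sumr; apply: eq_bigr => g _.
elim/big_rec: _ => [|x y _ h]; first by rewrite mulr1 mul1r.
by rewrite -mulrA h !mulrA ud.
Qed.

Lemma nwhite_recolor l (p : cpart l) s : nwhite (recolor p s) = (\sum_(x < l) s x)%N.
Proof. by apply: eq_bigr => x _; rewrite ffunE. Qed.
Lemma nblack_recolor l (p : cpart l) s : nblack (recolor p s) = (\sum_(x < l) ~~ s x)%N.
Proof. by apply: eq_bigr => x _; rewrite ffunE. Qed.

Lemma alternating_balanced l : ~~ odd l ->
  (\sum_(x < l) odd x = \sum_(x < l) ~~ odd x)%N.
Proof.
move=> el; rewrite -(even_halfK el); elim: (l./2) => [|m IHm]; first by rewrite !big_ord0.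
by rewrite doubleS !big_ord_recr/= odd_double/= !addn0 IHm.
Qed.

Lemma nwhite_white l (p : cpart l) :
  (forall x, color p x) -> nwhite p = l /\ nblack p = 0%N.
Proof.
move=> h; have e : nblack p = 0%N by apply: big1 => x _; rewrite h.
by split=> //; have := nwhite_nblack p; rewrite e addn0.
Qed.

Section ChooseSign.
Variables (A D : cstarType R) (h : 'M[A]_n) (w : 'M[D]_n) (k : nat).
Hypothesis oh : Oplus_rel h.
Hypothesis hw : forall l (p : cpart l), part_rel h p ->
  nwhite p = nblack p %[mod k] -> part_rel w p.

Let sh : real_mx h. Proof. by case: oh. Qed.

(** Colored alternately, a partition with an even number of points has color sum
    0, so that w satisfies its relation whatever k is. *)
Lemma split_part_rel_even z u l (p : cpart l) : splits w z u -> ~~ odd l ->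
  part_rel h p -> part_rel u p.
Proof.
move=> [zz' z'z ou uz wE] el hp; have [su _ _] := ou.
pose s (x : 'I_l) := odd x.
have bal : nwhite (recolor p s) = nblack (recolor p s).
  by rewrite nwhite_recolor nblack_recolor alternating_balanced.
apply/(part_rel_recolor p s su)/(part_rel_scaled zz' z'z su uz wE).
  by rewrite (@zpow_sum _ _ _ _ _ 0)// bal addn0.
by apply: hw; [exact/part_rel_recolor|rewrite bal].
Qed.

(** A white partition with l points, completed by pairs to l k points (possible as
    k is odd), has color sum divisible by k.  The pairs can be removed
    afterwards, because u satisfies their relation. *)
Lemma split_part_rel_odd z u : splits w z u -> z ^+ k = 1 -> odd k ->
  forall l (p : cpart l), part_rel h p -> part_rel u p.
Proof.
move=> [zz' z'z ou uz wE] zk ok l p hp; have [su _ _] := ou.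
pose p' := recolor p xpredT; pose m := (l * k./2)%N.
have [q1 q2] := nwhite_white (@color_pairing m).
have [|p1 p2] := @nwhite_white _ p'; first by move=> x; rewrite ffunE.
pose q := ptens p' (pairing m).
have qk : nwhite q = nblack q %[mod k].
  rewrite nwhite_tens nblack_tens p1 p2 q1 q2 mod0n.
  have -> : (l + m.*2 = l * k)%N.
    by rewrite /m -{2}(odd_double_half k) ok -!muln2; lia.
  exact: modnMl.
have hq : part_rel h q.
  by apply: part_rel_tens; [exact/part_rel_recolor|exact: part_rel_pairing].
have /part_relE uq : part_rel u q.
  apply/(part_rel_scaled zz' z'z su uz wE); last exact: hw.
  exact: zpow_eq1 zk qk.
apply/part_relE => b; rewrite -(rho_recolor p xpredT)//.
have /part_relE ue := part_rel_pairing (m := m) ou.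
have := uq (fcat b [ffun=> Ordinal n0]).
by rewrite rho_tens delta_tens fcat_lshift fcat_rshift ue delta_const mulr1 andbT => ->.
Qed.

(** Only partitions with an odd number of points are in question.  The tensor
    product of any two of them is even, so all their transported vectors are
    multiples of the original ones by the same scalar r, with r^2 = 1;
    reflection shows that r is self-adjoint, and [rho_rotate], applied to an odd
    partition followed by a pair, that u r u^T = r, so that r is central.  The
    factor r is then moved from u to z; this preserves z^k = 1 as k is even. *)
Lemma split_choose_sign z u : splits w z u -> z ^+ k = 1 -> ~~ odd k ->
  exists z' u', [/\ splits w z' u', z' ^+ k = 1
    & forall l (p : cpart l), part_rel h p -> part_rel u' p].
Proof.
move=> hs zk ek.
have [[l0 [p0 [ol0 hp0]]]|no] := pselect (exists l (p : cpart l), odd l /\ part_rel h p);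
    last first.
  exists z, u; split=> // l p hp; apply: (split_part_rel_even hs _ hp).
  by apply/negP => ol; apply: no; exists l, p.
case: l0 p0 ol0 hp0 => // l0 p0 ol0 hp0.
have [zz' z'z ou uz wE] := hs; have [su _ _] := ou; have Uu := Oplus_Uplus ou.
have Uh := Oplus_Uplus oh.
pose c0 := Ordinal n0; pose r := rho u p0 [ffun=> c0].
have pp l (p : cpart l) l' (p' : cpart l') b b' : odd l -> odd l' ->
    part_rel h p -> part_rel h p' ->
    rho u p b * rho u p' b' = (delta p b && delta p' b')%:R.
  move=> ol ol' hp hp'.
  have : part_rel u (ptens p p').
    apply: (split_part_rel_even hs); first by rewrite oddD ol ol'.
    exact: part_rel_tens.
  move=> /part_relE.
  by move=> /(_ (fcat b b')); rewrite rho_tens delta_tens fcat_lshift fcat_rshift.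
have rr : r * r = 1 by rewrite pp// delta_const.
have rq l (p : cpart l) b : odd l -> part_rel h p -> rho u p b = (delta p b)%:R * r.
  move=> ol hp; have <- : rho u p b * (r * r) = rho u p b by rewrite rr mulr1.
  by rewrite mulrA pp// delta_const andbT.
have sr : star r = r.
  have e : fcomp (@rev_ord l0.+1) [ffun=> c0] = [ffun=> c0].
    by apply/ffunP => x; rewrite !ffunE.
  rewrite /r -{1}e -rho_reflect rq//; last exact: part_rel_reflect.
  by rewrite delta_const mul1r.
have rz : z * r = r * z by rewrite rho_commute.
have E a1 a2 : \sum_d u a2 d * r * u a1 d = (a1 == a2)%:R * r.
  (* rotating q moves one leg of the pair in front of p0 *)
  pose q : cpart (l0 + 2).+1 := ptens p0 (sqcap true true).
  have oq : odd (l0 + 2).+1 by rewrite -addSn oddD ol0.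
  have hq : part_rel h q.
    have : part_rel h (ptens p0 (sqcap true true)) by
      apply: part_rel_tens => //; exact: part_rel_sqcap_real.
    by [].
  (* constant a1 except on the last point, which is paired with the one before *)
  pose b' : {ffun 'I_(l0 + 2).+1 -> 'I_n} := set_last [ffun=> a1] a2.
  pose b := fcomp (@ord_pred (l0 + 2).+1) b'.
  have bb' : fcomp (@ordS (l0 + 2).+1) b = b' by apply/ffunP => x; rewrite !ffunE ordSK.
  have db c : delta q (set_last [ffun=> a1] c) = (a1 == c).
    rewrite [LHS](delta_tens p0) delta_sqcap.
    have -> : fcomp (@lshift l0.+1 2) (set_last [ffun=> a1] c) = [ffun=> a1].
      apply/ffunP => x; rewrite !ffunE; case: eqP => // /(congr1 (@nat_of_ord _)) e.
      by have := ltn_ord x; have -> : (x : nat) = (l0 + 2)%N := e; lia.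
    rewrite delta_const !ffunE.
    have -> : (rshift l0.+1 (ord0 : 'I_2) == ord_max :> 'I_(l0 + 2).+1) = false.
      apply/eqP => /(congr1 (@nat_of_ord _)) e.
      by have : (l0.+1 + 0 = l0 + 2)%N := e; lia.
    rewrite ifT//; apply/eqP/ord_inj; change (l0.+1 + 1 = l0 + 2)%N; lia.
  have := rho_rotate Uu b (fun b => rq _ q b oq hq).
  rewrite rq//; last exact: part_rel_rotate.
  rewrite delta_rotate bb' db.
  have ue c : set_last b' c = set_last [ffun=> a1] c :> {ffun 'I_(l0 + 2).+1 -> 'I_n}.
    by apply/ffunP => x; rewrite !ffunE; case: eqP.
  under eq_bigl do rewrite ue db.
  rewrite (big_pred1 a1) => [->|c]; last by rewrite /= eq_sym.
  apply: eq_bigr => d _.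
  rewrite !colored_real// su !ffunE; congr (u _ d * _ * _).
  case: eqP => // -[]; apply: ord_inj.
  by rewrite /= modn_small.
have ur a c : u a c * r = r * u a c.
  have [_ _ h2] := ou.
  have -> : r * u a c = \sum_a1 (\sum_d u a d * r * u a1 d) * u a1 c.
    under eq_bigr do rewrite E.
    rewrite (bigD1 a)//= eqxx mul1r big1 ?addr0// => a1 /negbTE ->.
    by rewrite !mul0r.
  under eq_bigr do rewrite mulr_suml.
  rewrite exchange_big/=.
  under eq_bigr => d _.
    under eq_bigr do rewrite -mulrA.
    rewrite -mulr_sumr (_ : \sum_i _ = (d == c)%:R); last first.
      have /matrixP /(_ d c) := h2; rewrite !mxE => <-.
      by apply: eq_bigr => x _; rewrite mxE.
    over.
  rewrite (bigD1 c)//= eqxx mulr1 big1 ?addr0// => d /negbTE ->.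
  by rewrite mulr0.
have hs' := splits_twist hs sr rr ur rz.
exists (z * r), (\matrix_(a, b) (r * u a b)); split=> //.
  rewrite exprMn_comm// zk mul1r -[k](even_halfK ek) -mul2n exprM expr2 rr expr1n//.
move=> l p hp; have [ol|el] := boolP (odd l); last exact: (split_part_rel_even hs' el hp).
apply/part_relE => b.
have rr' : r * star r = 1 by rewrite sr.
have r'r : star r * r = 1 by rewrite sr.
rewrite (rho_scaled rr' r'r su ur); last by move=> a c; rewrite mxE.
have rl : r ^+ l = r.
  by rewrite -[in LHS](odd_double_half l) ol exprS -mul2n exprM expr2 rr expr1n mulr1.
by rewrite rq// /zpow sr -exprD nwhite_nblack rl -commr_nat mulrA rr mul1r.
Qed.

End ChooseSign.

(** Pairs alone give z^k = 1 for even k and z^2k = 1 for odd k.  After that the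
    parity of k decides how the relations of partitions with an odd number of
    points are obtained. *)
Lemma complexification_split (A B : cstarType R) (h : 'M[A]_n) (w : 'M[B]_n) (k : nat) :
  Oplus_rel h -> Uplus_rel w ->
  (forall l (p : cpart l), part_rel h p -> nwhite p = nblack p %[mod k] ->
     part_rel w p) ->
  exists (D : cstarType R) (e : starHom B D) (E : D -> B) (z : D) (u : 'M[D]_n),
    [/\ cancel e E, forall x y, rnorm (E x - E y) <= rnorm (x - y),
      splits (hom_mx e w) z u, z ^+ k = 1
      & forall l (p : cpart l), part_rel h p -> part_rel u p].
Proof.
move=> oh hw hp.
have gc : part_rel w (ptens (sqcap white white) (sqcap black black)).
  apply: hp; first by apply: part_rel_tens; exact: part_rel_sqcap_real.
  by rewrite nwhite_tens nblack_tens /nwhite /nblack !big_ord_recl !big_ord0 !color_sqcap.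
have [D [e [E [z0 [u0 [eK Ec hs0]]]]]] := root_extension n0 hw gc.
have hp' l (p : cpart l) : part_rel h p -> nwhite p = nblack p %[mod k] ->
    part_rel (hom_mx e w) p.
  by move=> ? ?; exact/part_rel_hom_mx/hp.
have pair j m : j.*2 = (m * k)%N -> z0 ^+ j.*2 = 1.
  move=> jm; have [q1 q2] := nwhite_white (@color_pairing j).
  have [zz' z'z _ _ _] := hs0.
  rewrite -(@zpow_sum _ _ _ _ (pairing j))//; last by rewrite q1 q2.
  apply: (zpow_even_size n0 hs0); first by rewrite odd_double.
  by apply: hp'; [exact: part_rel_pairing|rewrite q1 q2 jm modnMl mod0n].
have [ok|ek] := boolP (odd k).
  have [|z [u [hs zk]]] := odd_root hs0 ok.
    by rewrite -exprD addnn; apply: (pair _ 2); rewrite -mul2n.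
  by exists D, e, E, z, u; split=> //; exact: (split_part_rel_odd oh hp' hs zk ok).
have zk0 : z0 ^+ k = 1.
  by rewrite -{1}(even_halfK ek); apply: (pair _ 1); rewrite mul1n even_halfK.
have [z [u [hs zk hu]]] := split_choose_sign oh hp' hs0 zk0 ek.
by exists D, e, E, z, u; split.
Qed.

End Complexification.

(** * Tensor complexifications are the globally colorized easy quantum groups *)

(** Gluing with a quantum group of size 1 gives size n * 1; the identification with
    size n is kept abstract so that it can be eliminated. *)
Definition glued_along (R : realType) (n m : nat) (e : n = m) (H : qgroup R n)
    (Z : qgroup R 1) (K : qgroup R m) : Prop :=
  exists (T : cstarType R) (i : starHom (qalg H) T) (j : starHom (qalg Z) T)
      (iota : starHom (qalg K) T),
    [/\ max_tensor i j, injective iota,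
        range iota = cstar_gen [set x | exists a b, x = i (qfund H a b) * j (qfund Z 0 0)]
      & forall a b, iota (qfund K (cast_ord e a) (cast_ord e b)) =
                    i (qfund H a b) * j (qfund Z 0 0)].

Lemma is_glued_along (R : realType) (n : nat) (H : qgroup R n) (Z : qgroup R 1)
    (K : qgroup R (n * 1)) : is_glued H Z K -> glued_along (esym (muln1 n)) H Z K.
Proof.
move=> [T [i [j [iota [mT iI ir iE]]]]]; exists T, i, j, iota; split=> //.
  rewrite ir; congr cstar_gen; apply/seteqP; split=> x [a [b]].
    by move=> [c [d ->]]; exists a, b; rewrite !ord1.
  by move=> ->; exists a, b, 0, 0.
have E (a : 'I_n) : cast_ord (esym (muln1 n)) a = mxtens_index (a, 0 : 'I_1).
  by apply: ord_inj; rewrite /= addn0 muln1.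
by move=> a b; rewrite !E iE.
Qed.

Section Main.
Variables (R : realType) (n : nat).
Hypothesis n0 : (0 < n)%N.

Lemma glued_easy_colorized (C : set cpartition) (m : nat) (e : n = m)
    (H : qgroup R n) (Z : qgroup R 1) (K : qgroup R m) :
  is_category C -> globally_colorized C ->
  easy_qg (generated_category (C `|` [set pack (sqcap white white)])) H ->
  is_dual_cyclic (kcat C) Z -> glued_along e H Z K -> easy_qg C K.
Proof.
case: _ / e K => K hC gC uH uZ [T [i [j [iota [mT iI ir iE]]]]].
have {}iE a b : iota (qfund K a b) = i (qfund H a b) * j (qfund Z 0 0).
  by rewrite -iE !cast_ord_id.
have [[rH pH] _ _] := uH.
have gen_sub k (p : cpart k) : (C `|` [set pack (sqcap white white)]) (pack p) ->
    part_rel (qfund H) p by move=> Cp; apply: pH => S [_]; apply.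
have oH : Oplus_rel (qfund H) by apply: Uplus_Oplus => //; apply: gen_sub; right.
split.
- split; first exact: (glued_Uplus uZ oH mT iI iE).
  move=> k p Cp; apply: (glued_part_rel uZ oH mT iI iE).
    by apply: gen_sub; left.
  exact: kcat_mod.
- exact: (glued_gen iI ir iE).
- move=> B w hw; have [D [e [E [z [u [eK Ec hs zk hu]]]]]] := colorized_split n0 hC gC hw.
  exact: (glued_univ uH uZ mT iI ir iE eK Ec hs zk hu).
Qed.

(** The category is the largest possible one: all partitions whose relation holds
    for the fundamental representation of K. *)
Lemma glued_easy_complexification (k : nat) (C : set cpartition) (m : nat) (e : n = m)
    (H : qgroup R n) (Z : qgroup R 1) (K : qgroup R m) :
  is_category C -> non_colored C -> easy_qg C H ->
  is_dual_cyclic k Z -> glued_along e H Z K ->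
  exists C' : set cpartition, [/\ is_category C', globally_colorized C' & easy_qg C' K].
Proof.
case: _ / e K => K hC nC uH uZ [T [i [j [iota [mT iI ir iE]]]]].
have {}iE a b : iota (qfund K a b) = i (qfund H a b) * j (qfund Z 0 0).
  by rewrite -iE !cast_ord_id.
have [[rH pH] _ _] := uH.
have oH : Oplus_rel (qfund H) by apply: Uplus_Oplus => //; exact: pH.
have rK := glued_Uplus uZ oH mT iI iE.
have pK l (p : cpart l) := @glued_part_rel _ _ _ _ _ _ uZ oH _ _ _ _ mT iI iE l p.
exists [set q : cpartition | part_rel (qfund K) (tagged q)]; split.
- exact: part_rel_category.
- apply: pK; first by apply: part_rel_tens; exact: part_rel_sqcap_real.
  by rewrite nwhite_tens nblack_tens /nwhite /nblack !big_ord_recl !big_ord0 !color_sqcap.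
split.
- by split=> // l p.
- exact: (glued_gen iI ir iE).
- move=> B w [hw hp].
  have [D [e [E [z [u [eK Ec hs zk hu]]]]]] :=
    complexification_split n0 oH hw (fun l p h1 h2 => hp l p (pK l p h1 h2)).
  apply: (glued_univ uH uZ mT iI ir iE eK Ec hs zk); split.
    exact/Oplus_Uplus/(split_orth hs).
  by move=> l p Cp; apply: hu; exact: pH.
Qed.

End Main.

Local Close Scope ring_scope.

Theorem theoremB (R : realType) :
  (forall (C : set cpartition) (n : nat)
     (H : qgroup R n) (Z : qgroup R 1) (K : qgroup R (n * 1)),
     is_category C -> globally_colorized C -> (0 < n)%N ->
     easy_qg (generated_category (C `|` [set pack (sqcap white white)])) H ->
     is_dual_cyclic (kcat C) Z ->
     is_glued H Z K ->
     [/\ orthogonal_qg H,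
         cmqg K,
         easy_qg C K,
         (forall G : qgroup R n, easy_qg C G -> qg_eq G K)
       & unitary_qg K])
  /\
  (forall (n k : nat)
     (H : qgroup R n) (Z : qgroup R 1) (K : qgroup R (n * 1)),
     (0 < n)%N ->
     orthogonal_easy H ->
     is_dual_cyclic k Z ->
     is_glued H Z K ->
     [/\ cmqg K,
         unitary_qg K
       & exists C : set cpartition,
           [/\ is_category C, globally_colorized C & easy_qg C K]]).
Proof.
split=> [C n H Z K hC gC n0 uH uZ /is_glued_along hK|].
  have uK := glued_easy_colorized n0 hC gC uH uZ hK; split=> //.
  - by apply: easy_orthogonal uH => S [_]; apply; right.
  - exact: easy_cmqg uK.
  - by move=> G uG; apply: (universal_eq (rel := @easy_rel R C) (esym (muln1 n)) uG uK).
  - exact: easy_unitary uK.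
move=> n k H Z K n0 [C [hC nC uH]] uZ /is_glued_along hK.
have [C' [hC' gC' uK]] := glued_easy_complexification n0 hC nC uH uZ hK.
by split; [exact: easy_cmqg uK|exact: easy_unitary uK|exists C'].
Qed.
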